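(* Let $\gamma_1,\gamma_2,\mu>0$ and consider the system for $(x,r,v_1,\dots,v_k)\in(\mathbb{R}^d)^{k+2}$ $$ \begin{aligned} \dot x&=r-\mu\sum_{i=1}^m c_i(x)\nabla c_i(x),\\ \dot r&=-\gamma_1 r-\gamma_2\Big(I-2\sum_{i=1}^k v_iv_i^\top\Big)\operatorname{grad} f(x)-A(x)(A(x)^\top A(x))^{-1}(\nabla^2C(x)\dot x)^\top r,\\ \dot v_i&=-\Big(I-v_iv_i^\top-2\sum_{j=1}^{i-1}v_jv_j^\top\Big)\widetilde{\operatorname{Hess}}f(x)[v_i]-A(x)(A(x)^\top A(x))^{-1}(\nabla^2C(x)\dot x)^\top v_i,\quad i=1,\dots,k, \end{aligned} $$ where $\dot x$ on the right-hand sides stands for the expression in the first line. Assume that $x^*\in\mathcal M$, that $v_1^*,\dots,v_{d-m}^*\in T_{x^*}\mathcal M$ satisfy $\|v_i^*\|=1$, and that the eigenvalues of $\operatorname{Hess}f(x^* )$ are $$\lambda_1^*<\cdots<\lambda_k^*<0<\lambda_{k+1}^*\le\cdots\le\lambda_{d-m}^*.$$ Then $(x^*,r^*,v_1^*,\dots,v_k^* )$ is a linearly stable steady state of the system if and only if $x^*$ is an index-$k$ saddle point, $r^*=0$, and $\operatorname{Hess}f(x^* )[v_i^*]=\lambda_i^*v_i^*$ for $i=1,\dots,k$.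
   Context: Let $f:\mathbb{R}^d\to\mathbb{R}$ and $c_1,\dots,c_m:\mathbb{R}^d\to\mathbb{R}$ be smooth, $C(x)=(c_1(x),\dots,c_m(x))$, $\mathcal M=\{x\in\mathbb{R}^d: C(x)=0\}$, and let $A(x)=(\nabla c_1(x),\dots,\nabla c_m(x))\in\mathbb{R}^{d\times m}$ have full column rank for all $x\in\mathcal M$ (hence also in a neighborhood of $\mathcal M$). Then $\mathcal M$ is a $(d-m)$-dimensional embedded submanifold, with $T_x\mathcal M=\{v\in\mathbb{R}^d:A(x)^\top v=0\}$. Put $P(x)=I-A(x)(A(x)^\top A(x))^{-1}A(x)^\top$, $\operatorname{grad}f(x)=P(x)\nabla f(x)$, and $$\operatorname{Hess}f(x)[v]=P(x)\big(\nabla^2f(x)v-(\nabla^2C(x)v)(A(x)^\top A(x))^{-1}A(x)^\top\nabla f(x)\big),\quad v\in T_x\mathcal M,$$ where $\nabla^2C(x)v$ denotes the $d\times m$ matrix with columns $\nabla^2c_i(x)v$. For $x\in\mathcal M$ this is the Riemannian Hessian, a self-adjoint operator on $T_x\mathcal M$. Put $\widetilde{\operatorname{Hess}}f(x)[v]=\operatorname{Hess}f(x)[P(x)v]$ for $v\in\mathbb{R}^d$. The same formulas are used for $x$ near $\mathcal M$. A point $x^*\in\mathcal M$ is a critical point if $\operatorname{grad}f(x^* )=0$; it is an index-$k$ saddle point if in addition $\operatorname{Hess}f(x^* )$ has exactly $k$ negative eigenvalues. Here $1\le k\le d-m-1$. A steady state is a point at which the right-hand side of the system vanishes. It is linearly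 stable if all eigenvalues of the Jacobian of the right-hand side (as a vector field on an open subset of $(\mathbb{R}^d)^{k+2}$) at this point have negative real part. *)

(* Defs.v *)
From HB Require Import structures.
From mathcomp Require Export all_boot all_order all_algebra.
From mathcomp Require Export all_classical all_reals all_analysis.
From mathcomp Require Export complex.

Set Implicit Arguments.
Unset Strict Implicit.
Unset Printing Implicit Defensive.

Export Order.TTheory GRing.Theory Num.Theory.
Export numFieldNormedType.Exports.
Local Open Scope ring_scope.

Section Calculus.
Variables (R : realType) (d : nat).
Implicit Types (g : 'cV[R]_d -> R) (x : 'cV[R]_d) (i : 'I_d).

Definition partial i g : 'cV[R]_d -> R := fun x => 'D_(delta_mx i 0) g x.

(* Infinite differentiability. Since every iterated partial derivative is again
   required to be differentiable, all of them are continuous. *)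
Definition smooth g : Prop :=
  forall (s : seq 'I_d) x, differentiable (foldr partial g s) x.

Definition gradient g x : 'cV[R]_d := \col_i partial i g x.

Definition hessian g x : 'M[R]_d := \matrix_(i, j) partial j (partial i g) x.

(* The norm `|v| of matrices in the library is the sup norm. *)
Definition enorm (v : 'cV[R]_d) : R := Num.sqrt (\sum_i v i 0 ^+ 2).

End Calculus.

Section Constraints.
Variables (R : realType) (d m : nat) (c : 'I_m -> 'cV[R]_d -> R).
Implicit Types (f : 'cV[R]_d -> R) (x v : 'cV[R]_d).

Definition constraint_set : set 'cV[R]_d := [set x | forall i, c i x = 0].

Definition cgrad x : 'M[R]_(d, m) := \matrix_(j, i) gradient (c i) x j 0.

Definition chess x v : 'M[R]_(d, m) :=
  \matrix_(j, i) (hessian (c i) x *m v) j 0.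

(* (A^T A)^-1 for A = cgrad x; invmx is the genuine inverse wherever A has full
   column rank, in particular in a neighbourhood of the constraint set. *)
Definition gram_inv x : 'M[R]_m := invmx ((cgrad x)^T *m cgrad x).

Definition tproj x : 'M[R]_d :=
  1%:M - cgrad x *m gram_inv x *m (cgrad x)^T.

Definition tangent x : {vspace 'cV[R]_d} :=
  lker (linfun (mulmx (cgrad x)^T) : 'Hom('cV[R]_d, 'cV[R]_m)).

Definition rgrad f x : 'cV[R]_d := tproj x *m gradient f x.

Definition rhess f x v : 'cV[R]_d :=
  tproj x *m (hessian f x *m v -
              chess x v *m gram_inv x *m (cgrad x)^T *m gradient f x).

Definition rhess_ext f x v : 'cV[R]_d := rhess f x (tproj x *m v).

(* The operator v |-> rhess f x v on the tangent space. The values of rhess are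
   already tangent when x is on the constraint set, so that vsproj only changes
   their type. *)
Definition rhess_op f x : 'End(subvs_of (tangent x)) :=
  linfun (fun v : subvs_of (tangent x) =>
    vsproj (tangent x) (rhess f x (vsval v))).

End Constraints.

(* s lists the eigenvalues of h with their multiplicities, and h has no others:
   its characteristic polynomial splits with roots s. *)
Definition eigenvalue_list (K : fieldType) (V : vectType K) (h : 'End(V))
    (s : seq K) : Prop :=
  char_poly (passmx.mxof (vbasis fullv) (vbasis fullv) h) =
  \prod_(a <- s) ('X - a%:P).

Section CriticalPoints.
Variables (R : realType) (d m : nat) (c : 'I_m -> 'cV[R]_d -> R).
Variable f : 'cV[R]_d -> R.

Definition critical_point (x : 'cV[R]_d) : Prop :=
  constraint_set c x /\ rgrad c f x = 0.

Definition index_saddle (k : nat) (x : 'cV[R]_d) : Prop :=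
  critical_point x /\
  exists2 s : seq R, eigenvalue_list (rhess_op c f x) s &
                     count (fun a => a < 0) s = k.

End CriticalPoints.

Section Stability.
Variables (R : realType) (p q : nat).
Variables (F : 'M[R]_(p, q) -> 'M[R]_(p, q)) (z : 'M[R]_(p, q)).

Definition steady_state : Prop := F z = 0.

(* Matrix of 'd F z in the coordinates given by mxvec. *)
Definition mx_jacobian : 'M[R]_(p * q) := lin_mx ('d F z).

Definition linearly_stable : Prop :=
  differentiable F z /\
  forall a : R[i],
    eigenvalue (map_mx (real_complex R) mx_jacobian) a -> complex.Re a < 0.

End Stability.

Section System.
Variables (R : realType) (d m k : nat) (c : 'I_m -> 'cV[R]_d -> R).
Variables (f : 'cV[R]_d -> R) (gamma1 gamma2 mu : R).

(* A point (x, r, v_1, ..., v_k) of (R^d)^(k+2) is the matrix with these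
   columns. *)
Local Notation state := 'M[R]_(d, 1 + (1 + k)).

Definition mk_state (x r : 'cV[R]_d) (v : 'I_k -> 'cV[R]_d) : state :=
  row_mx x (row_mx r (\matrix_(j, i) v i j 0)).

Definition st_x (z : state) : 'cV[R]_d := lsubmx z.
Definition st_r (z : state) : 'cV[R]_d := lsubmx (rsubmx z).
Definition st_v (z : state) (i : 'I_k) : 'cV[R]_d := col i (rsubmx (rsubmx z)).

(* A (A^T A)^-1 (nabla^2 C(x) u)^T w, where A is cgrad c x. *)
Definition normal_term (x u w : 'cV[R]_d) : 'cV[R]_d :=
  cgrad c x *m gram_inv c x *m (chess c x u)^T *m w.

Definition xdot (z : state) : 'cV[R]_d :=
  st_r z - mu *: \sum_(i < m) c i (st_x z) *: gradient (c i) (st_x z).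

Definition rdot (z : state) : 'cV[R]_d :=
  - (gamma1 *: st_r z)
  - gamma2 *: ((1%:M - 2 *: \sum_(i < k) st_v z i *m (st_v z i)^T)
               *m rgrad c f (st_x z))
  - normal_term (st_x z) (xdot z) (st_r z).

Definition vdot (z : state) (i : 'I_k) : 'cV[R]_d :=
  - ((1%:M - st_v z i *m (st_v z i)^T
      - 2 *: \sum_(j < k | (j < i)%N) st_v z j *m (st_v z j)^T)
     *m rhess_ext c f (st_x z) (st_v z i))
  - normal_term (st_x z) (xdot z) (st_v z i).

Definition system_rhs (z : state) : state :=
  mk_state (xdot z) (rdot z) (vdot z).

End System.

(* Main.v *)
Require Import Defs.
From HB Require Import structures.
From mathcomp Require Import spectral sesquilinear.
From mathcomp Require Import ring lra zify.

Set Implicit Arguments.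
Unset Strict Implicit.
Unset Printing Implicit Defensive.
Local Open Scope classical_set_scope.
Local Open Scope ring_scope.

(** Write P for the projection onto the tangent space, L for the Hessian of the
Lagrangian f - sum_i y_i c_i with the least-squares multipliers
y = (A^T A)^-1 A^T grad f, and K = P L P for the symmetric matrix of the
Riemannian Hessian extended by zero to normal vectors. Symmetry of K rests on
the equality of mixed derivatives ([derive_mixedC]).

Steady states. On the constraint set the first equation forces r = 0. The
equations for the v_i then say that each K v_i is a prescribed combination of
v_1, ..., v_i; because K is symmetric and has no zero eigenvalue on the tangent
space, induction on i shows that the v_i are orthonormal eigenvectors
([deflated_eigenvectors]). Hence 1 - 2 sum_i v_i v_i^T is an involution and
grad f = 0 on the manifold. A steady state is thus a critical point with r = 0
together with any k orthonormal eigenvectors; which eigenvectors is decided by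
stability.

Linearization. At such a point grad f, r and the velocity of x all vanish, so
every product with one of these factors contributes only through the derivative
of that factor. In particular P A = 0 near x gives
grad f = P (nabla f - A y) with y held constant, whence the derivative of grad f
is u |-> P L u ([is_derive_rgrad]). The linearized (x, r) equations do not
involve the v_i, and the linearized v_i equation involves only v_1, ..., v_i
besides (x, r): the Jacobian is block triangular.

Stable implies ordered. Let a_i be the eigenvalue of v_i. Stretching v_i along
itself is an eigenvector of the Jacobian with eigenvalue 2 a_i, and rotating v_i
towards v_l with i < l is one with eigenvalue a_i - a_l ([deflation_diff_self],
[deflation_diff_swap]). Stability therefore gives a_1 < ... < a_k < 0. Only k of
the lambda_i are negative, so a_i = lambda_i.

Ordered implies stable. Take a complex eigenvalue of the Jacobian with
nonnegative real part, and write its eigenvector as a pair of real vectors.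
The normal part of r is damped with rate gamma_1, the normal part of x by
mu A A^T, and in an orthonormal eigenbasis of K each tangential pair (x, r) is an
oscillator with friction gamma_1 and stiffness gamma_2 |b|, where b is the
eigenvalue; all of them must vanish. Then the v_i vanish one after the other,
because the i-th diagonal block is diagonal in the eigenbasis with negative
entries ([no_unstable_pair]). The simplicity of lambda_1, ..., lambda_k as
eigenvalues of K, which makes each v_i a vector of the eigenbasis up to sign,
comes from comparing the characteristic polynomials of K and of the Riemannian
Hessian ([char_poly_rhess]). *)

(** * Diagonalization of real symmetric matrices *)

(** Over R[i] the matrix is unitarily diagonalizable with real eigenvalues, and
they cannot all vanish. An eigenvalue is a root of the characteristic
polynomial, so a real one has a real eigenvector too. *)
Lemma symmetric_nz_eigenvalue (R : rcfType) n (S : 'M[R]_n) :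
  S^T = S -> S != 0 -> exists2 b, b != 0 & eigenvalue S b.
Proof.
move=> symS nzS; pose C := (R[i] : numClosedFieldType).
pose Sc : 'M[C]_n := map_mx (real_complex R) S.
have hermS : Sc \is hermsymmx.
  apply: realsym_hermsym.
    by apply/is_hermitianmxP; rewrite expr0 scale1r map_mx_id // /Sc map_trmx symS.
  by apply/mxOverP => i j; rewrite mxE; apply/complex_realP; exists (S i j).
have normS := hermitian_normalmx hermS.
have defS := orthomx_spectralP normS.
set U := spectralmx Sc in defS; set s := spectral_diag Sc in defS.
have unitU : U \in unitmx := spectral_unit Sc.
have [i nz_si] : exists i, s 0 i != 0.
  apply/existsP; apply: contraNT nzS; rewrite negb_exists => /forallP s0.
  have {}s0 : s = 0.
    by apply/rowP => i; rewrite !mxE; apply/eqP; have := s0 i; rewrite negbK.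
  have : Sc == 0 by rewrite defS s0 linear0 mulmx0 mul0mx.
  by rewrite map_mx_eq0.
have /mxOverP/(_ 0 i)/complex_realP[b sib] := hermitian_spectral_diag_real hermS.
exists b.
  by apply: contraNneq nz_si => b0; rewrite /s sib b0.
rewrite eigenvalue_root_char -(fmorph_root (real_complex R)) map_char_poly /=.
rewrite -eigenvalue_root_char; apply/eigenvalueP; exists (row i U).
  have -> : real_complex R b = s 0 i by rewrite /s sib.
  rewrite -/Sc defS -row_mul !mulmxA mulmxV // mul1mx.
  by apply/rowP => j; rewrite row_mul row_diag_mx -scalemxAl -rowE.
apply/negP => /eqP Ui0.
have := unitU; rewrite -row_free_unit -kermx_eq0 => /eqP k0.
have : ((delta_mx 0 i : 'rV[C]_n) <= kermx U)%MS by apply/sub_kermxP; rewrite -rowE Ui0.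
rewrite k0 submx0 => /eqP/rowP/(_ i); rewrite !mxE !eqxx /=.
by move/eqP; rewrite oner_eq0.
Qed.

(** An orthonormal family of s < n eigenvectors is extended by one: the
projection Q onto its orthogonal complement commutes with K, so a nonzero
eigenvalue of Q K gives an eigenvector in the complement, and if Q K = 0 any
nonzero row of Q is one. *)
Theorem symmetric_diagonalization (R : rcfType) n (K : 'M[R]_n) : K^T = K ->
  exists E : 'M[R]_n, exists b : 'rV[R]_n,
    E *m E^T = 1%:M /\ E *m K = diag_mx b *m E.
Proof.
move=> symK; suff: forall s, (s <= n)%N -> exists E : 'M[R]_(s, n),
    exists b : 'rV[R]_s, E *m E^T = 1%:M /\ E *m K = diag_mx b *m E.
  exact.
elim=> [_|s IHs lt_sn].
  by exists 0, 0; split; apply/matrixP => -[].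
have [E [b [EET EK]]] := IHs (ltnW lt_sn).
pose Q := 1%:M - E^T *m E.
have symQ : Q^T = Q by rewrite /Q linearB /= trmx_mul trmxK trmx1.
have EQ : E *m Q = 0 by rewrite mulmxBr mulmx1 mulmxA EET mul1mx subrr.
have QQ : Q *m Q = Q by rewrite {1}/Q mulmxBl mul1mx -mulmxA EQ mulmx0 subr0.
have nzQ : Q != 0.
  apply: contraTneq lt_sn => /eqP; rewrite subr_eq0 -leqNgt => /eqP Q0.
  rewrite -[n in (n <= _)%N](mxrank1 R n) Q0.
  exact: leq_trans (mxrankM_maxr _ _) (rank_leq_row _).
have QK : Q *m K = K *m Q.
  rewrite /Q mulmxBl mulmxBr mul1mx mulmx1; congr (_ - _).
  apply: (can_inj trmxK); rewrite -mulmxA EK [RHS]trmx_mul symK.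
  by rewrite !trmx_mul trmxK tr_diag_mx -!mulmxA EK.
have [u [a [nzu uQ uK]]] : exists u : 'rV[R]_n, exists a,
    [/\ u != 0, u *m Q = u & u *m K = a *: u].
  have [QK0|nzQK] := eqVneq (Q *m K) 0.
    have [i nzQi] : exists i, row i Q != 0.
      apply/existsP; apply: contraNT nzQ; rewrite negb_exists => /forallP Q0.
      by apply/eqP/row_matrixP => i; rewrite row0; apply/eqP; rewrite -[_ == _]negbK.
    exists (row i Q), 0; split => //; first by rewrite -row_mul QQ.
    by rewrite -row_mul QK0 row0 scale0r.
  have symQK : (Q *m K)^T = Q *m K by rewrite trmx_mul symQ symK QK.
  have [a nza /eigenvalueP[u uQK nzu]] := symmetric_nz_eigenvalue symQK nzQK.
  have uQ : u *m Q = u.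
    apply: (scalerI nza); rewrite scalemxAl -uQK -mulmxA -mulmxA.
    by rewrite -QK mulmxA mulmxA -[in LHS](mulmxA u) QQ -mulmxA.
  by exists u, a; split=> //; rewrite -{1}uQ -mulmxA.
pose c := (u *m u^T) 0 0.
have c_gt0 : 0 < c.
  rewrite lt_def /c mxE; under eq_bigr do rewrite mxE -expr2.
  rewrite sumr_ge0 ?andbT; last by move=> *; rewrite sqr_ge0.
  apply: contraNneq nzu => /psumr_eq0P u0; apply/eqP/rowP => j; rewrite mxE.
  by apply/eqP; rewrite -sqrf_eq0; apply/eqP/u0 => // *; rewrite sqr_ge0.
pose w := (Num.sqrt c)^-1 *: u.
have ww : w *m w^T = 1%:M.
  rewrite [w^T]linearZ /= -scalemxAl -scalemxAr scalerA [u *m _]mx11_scalar -/c.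
  rewrite scale_scalar_mx -invfM -expr2 sqr_sqrtr ?mulVf ?gt_eqF //; exact: ltW.
have wE : w *m E^T = 0.
  by rewrite -scalemxAl -uQ -mulmxA -[Q]symQ -trmx_mul EQ trmx0 mulmx0 scaler0.
pose E' : 'M[R]_(1 + s, n) := col_mx w E.
pose b' : 'rV[R]_(1 + s) := row_mx a%:M b.
suff: E' *m E'^T = 1%:M /\ E' *m K = diag_mx b' *m E' by exists E', b'.
split; rewrite /E' /b'.
  rewrite tr_col_mx mul_col_row ww wE EET -[E *m w^T]trmxK trmx_mul trmxK wE.
  by rewrite trmx0 -scalar_mx_block.
rewrite mul_col_mx EK diag_mx_row mul_block_col !mul0mx addr0 add0r.
have -> : diag_mx a%:M = a%:M :> 'M[R]_1.
  by apply/matrixP => i j; rewrite !ord1 !mxE eqxx.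
by rewrite mul_scalar_mx -scalemxAl uK !scalerA mulrC.
Qed.

(** Both sides are 'X^q times the determinant of the block matrix with rows
('X, U) and (V, 1), in which V is eliminated by the pivot 1 or by the pivot 'X. *)
Lemma char_poly_mulmxC (R : comNzRingType) p q (U : 'M[R]_(p, q))
    (V : 'M[R]_(q, p)) :
  'X^q * char_poly (U *m V) = 'X^p * char_poly (V *m U).
Proof.
pose U' : 'M[{poly R}]_(p, q) := map_mx polyC U.
pose V' : 'M[{poly R}]_(q, p) := map_mx polyC V.
pose B := block_mx ('X%:M : 'M[{poly R}]_p) U' V' 1%:M.
have detB : \det B = char_poly (U *m V).
  have <- : \det (B *m block_mx 1%:M 0 (- V') 1%:M) = \det B.
    by rewrite det_mulmx det_lblock !det1 !mulr1.
  rewrite mulmx_block !mulmx1 mul1mx !mulmx0 !add0r mulmxN subrr.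
  by rewrite det_ublock det1 mulr1 /char_poly /char_poly_mx map_mxM.
have : \det (block_mx 1%:M 0 (- V') 'X%:M *m B) = 'X^q * \det B.
  by rewrite det_mulmx det_lblock det1 mul1r det_scalar.
rewrite detB => <-; rewrite mulmx_block !mul1mx !mul0mx !addr0 mulmx1 !mulNmx.
rewrite mul_mx_scalar mul_scalar_mx addNr det_ublock det_scalar.
by rewrite addrC /char_poly /char_poly_mx map_mxM.
Qed.

(** * The Euclidean inner product and deflated eigenvector equations *)

Section Dot.
Variables (R : realType) (d : nat).
Implicit Types (u v w : 'cV[R]_d) (a : R).

Definition dot u v : R := (u^T *m v) 0 0.

Lemma dotE u v : u^T *m v = (dot u v)%:M.
Proof. exact: mx11_scalar. Qed.

Lemma dot_sum u v : dot u v = \sum_i u i 0 * v i 0.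
Proof. by rewrite /dot mxE; apply: eq_bigr => i _; rewrite mxE. Qed.

Lemma dotC u v : dot u v = dot v u.
Proof. by rewrite !dot_sum; apply: eq_bigr => i _; rewrite mulrC. Qed.

Lemma dotDr u v w : dot u (v + w) = dot u v + dot u w.
Proof. by rewrite /dot mulmxDr mxE. Qed.

Lemma dotZr u a v : dot u (a *: v) = a * dot u v.
Proof. by rewrite /dot -scalemxAr mxE. Qed.

Lemma dotNr u v : dot u (- v) = - dot u v.
Proof. by rewrite /dot mulmxN mxE. Qed.

Lemma dot0r u : dot u 0 = 0.
Proof. by rewrite /dot mulmx0 mxE. Qed.

Lemma dot_sumr (I : Type) (s : seq I) (Q : pred I) u (F : I -> 'cV[R]_d) :
  dot u (\sum_(i <- s | Q i) F i) = \sum_(i <- s | Q i) dot u (F i).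
Proof. by rewrite /dot mulmx_sumr summxE. Qed.

Lemma dot_ge0 u : 0 <= dot u u.
Proof. by rewrite dot_sum sumr_ge0 // => i _; rewrite -expr2 sqr_ge0. Qed.

Lemma dot_eq0 u : (dot u u == 0) = (u == 0).
Proof.
apply/eqP/eqP => [|->]; last exact: dot0r.
rewrite dot_sum => /psumr_eq0P u0; apply/colP => i; rewrite mxE.
apply/eqP; rewrite -sqrf_eq0 expr2 u0 // => j _.
by rewrite -expr2 sqr_ge0.
Qed.

Lemma mul_outer u v w : u *m v^T *m w = dot v w *: u.
Proof. by rewrite -mulmxA dotE mul_mx_scalar. Qed.

Lemma dot_adj p (A : 'M[R]_(d, p)) u (w : 'cV[R]_p) :
  dot u (A *m w) = (((A^T *m u)^T *m w)) 0 0.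
Proof. by rewrite /dot trmx_mul trmxK mulmxA. Qed.

Lemma dot_sym (K : 'M[R]_d) u v : K^T = K -> dot u (K *m v) = dot (K *m u) v.
Proof. by move=> symK; rewrite dot_adj symK. Qed.

Lemma enorm1_dot u : enorm u = 1 -> dot u u = 1.
Proof.
move=> u1; rewrite dot_sum; under eq_bigr do rewrite -expr2.
rewrite -[LHS]sqr_sqrtr -?/(enorm u) ?u1 ?expr1n //.
by apply: sumr_ge0 => i _; rewrite sqr_ge0.
Qed.

Lemma mul_outer_sum (I : finType) (v : I -> 'cV[R]_d) (Q : pred I) w :
  (\sum_(i | Q i) v i *m (v i)^T) *m w = \sum_(i | Q i) dot (v i) w *: v i.
Proof. by rewrite mulmx_suml; apply: eq_bigr => i _; rewrite mul_outer. Qed.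

Lemma eigen_ortho (K : 'M[R]_d) u v a b : K^T = K ->
  K *m u = a *: u -> K *m v = b *: v -> a != b -> dot u v = 0.
Proof.
move=> symK Ku Kv neq; have := dot_sym u v symK.
rewrite Ku Kv dotZr dotC [RHS]dotC dotZr => /eqP.
rewrite -subr_eq0 -mulrBl mulf_eq0 subr_eq0 eq_sym (negPf neq) /= => /eqP.
by rewrite dotC.
Qed.

Section Orthonormal.
Variables (I : finType) (v : I -> 'cV[R]_d).
Hypothesis v_on : forall i j, dot (v i) (v j) = (i == j)%:R.

Lemma householder_invol :
  (1%:M - 2 *: \sum_i v i *m (v i)^T) *m (1%:M - 2 *: \sum_i v i *m (v i)^T) = 1%:M.
Proof.
set W := \sum_i _.
have WW : W *m W = W.
  rewrite {2}/W mulmx_sumr; apply: eq_bigr => j _.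
  rewrite mulmxA mul_outer_sum (bigD1 j) //= v_on eqxx scale1r big1 ?addr0 //.
  by move=> i neq; rewrite v_on (negPf neq) scale0r.
rewrite mulmxBl mul1mx mulmxBr mulmx1 -scalemxAl -scalemxAr WW.
rewrite scalerA -scalerBl (_ : 2 - 2 * 2 = - 2 :> R); last by ring.
by rewrite scaleNr opprK subrK.
Qed.

End Orthonormal.

(** Write a_i for the Rayleigh quotient of v_i and suppose that v_1, ..., v_(i-1)
are orthonormal eigenvectors. Testing the i-th equation against v_l, l < i,
gives <v_l, v_i> (a_i + a_l) = 0, and against v_i gives
sum_(l < i) a_l <v_l, v_i>^2 = 0. If some <v_j, v_i> were nonzero, all a_l in
the last sum with nonzero coefficient would be - a_i, so a_i = 0 and then
a_j = 0, which is excluded. *)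
Lemma deflated_eigenvectors k (K : 'M[R]_d) (v : 'I_k -> 'cV[R]_d) :
  K^T = K -> (forall i, dot (v i) (v i) = 1) ->
  (forall i a, K *m v i = a *: v i -> a != 0) ->
  (forall i : 'I_k, (1%:M - v i *m (v i)^T
      - 2 *: \sum_(j < k | (j < i)%N) v j *m (v j)^T) *m (K *m v i) = 0) ->
  (forall i j, dot (v i) (v j) = (i == j)%:R) /\
  (forall i, K *m v i = dot (v i) (K *m v i) *: v i).
Proof.
move=> symK v1 nz_eig steady; pose a i := dot (v i) (K *m v i).
have eqK i : K *m v i = a i *: v i +
    2 *: \sum_(j < k | (j < i)%N) dot (v j) (K *m v i) *: v j.
  have /eqP := steady i; rewrite !mulmxBl mul1mx mul_outer -scalemxAl mul_outer_sum.
  by rewrite -addrA -opprD subr_eq0 => /eqP.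
have main : forall (n : nat) (i : 'I_k), (i < n)%N ->
    K *m v i = a i *: v i /\ forall j : 'I_k, (j < i)%N -> dot (v j) (v i) = 0.
  elim=> // n IHn i; rewrite ltnS => le_in.
  have IH (j : 'I_k) : (j < i)%N -> K *m v j = a j *: v j /\
      forall j' : 'I_k, (j' < j)%N -> dot (v j') (v j) = 0.
    by move=> lt_ji; apply: IHn; apply: leq_trans lt_ji le_in.
  have ortho (j l : 'I_k) : (j < i)%N -> (l < i)%N -> j != l -> dot (v j) (v l) = 0.
    move=> ji li; rewrite neq_ltn => /orP[lt|lt]; last rewrite dotC.
      by case: (IH l li) => _; apply.
    by case: (IH j ji) => _; apply.
  have KE : K *m v i = a i *: v i +
      2 *: \sum_(j < k | (j < i)%N) (a j * dot (v j) (v i)) *: v j.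
    rewrite [LHS]eqK; congr (_ + 2 *: _); apply: eq_bigr => j ji.
    by rewrite dot_sym // (IH j ji).1 dotC dotZr [dot (v i) _]dotC.
  have all0 (j : 'I_k) : (j < i)%N -> dot (v j) (v i) = 0.
    move=> ji; apply/eqP/negP => /negP nz.
    have rel (l : 'I_k) : (l < i)%N -> dot (v l) (v i) * (a i + a l) = 0.
      move=> li; have := congr1 (dot (v l)) KE.
      rewrite dot_sym // (IH l li).1 dotC dotZr dotDr !dotZr dot_sumr.
      rewrite (bigD1 l) //= big1 => [|j' /andP[j'i nj']]; last first.
        by rewrite dotZr (ortho l j') ?mulr0 // 1?eq_sym.
      by rewrite addr0 dotZr v1 mulr1 [dot (v i) (v l)]dotC => E; lra.
    have sum0 : \sum_(l < k | (l < i)%N) a l * dot (v l) (v i) ^+ 2 = 0.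
      have := congr1 (dot (v i)) KE.
      rewrite -/(a i) dotDr !dotZr v1 mulr1 dot_sumr => E.
      have {E} : 2 * \sum_(l < k | (l < i)%N) dot (v i)
          ((a l * dot (v l) (v i)) *: v l) = 0 by apply: (addrI (a i)); rewrite addr0 -E.
      move/eqP; rewrite mulf_eq0 pnatr_eq0 /= => /eqP s0.
      rewrite -[RHS]s0; apply: eq_bigr => l _.
      by rewrite dotZr [dot (v i) _]dotC expr2 mulrA.
    have : a i * \sum_(l < k | (l < i)%N) dot (v l) (v i) ^+ 2 = 0.
      rewrite -[RHS]oppr0 -[in RHS]sum0 -sumrN mulr_sumr; apply: eq_bigr => l li.
      by have := congr1 ( *%R (dot (v l) (v i))) (rel l li); lra.
    move/eqP; rewrite mulf_eq0 => /orP[/eqP ai0|].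
      have /eqP := rel j ji; rewrite mulf_eq0 (negPf nz) ai0 add0r /= => aj0.
      by have := nz_eig j _ (IH j ji).1; rewrite aj0.
    move=> /eqP /psumr_eq0P s0; move: nz; rewrite -sqrf_eq0 s0 ?eqxx // => l _.
    exact: sqr_ge0.
  split=> //; rewrite KE big1 ?scaler0 ?addr0 // => j ji.
  by rewrite all0 // mulr0 scale0r.
split=> [i j|i]; last exact: (main i.+1 i (ltnSn i)).1.
case: eqVneq => [->|]; first exact: v1.
rewrite neq_ltn => /orP[lt|lt]; last rewrite dotC.
  exact: (main j.+1 j (ltnSn j)).2.
exact: (main i.+1 i (ltnSn i)).2.
Qed.

End Dot.

(** * Coordinates in an orthonormal eigenbasis *)

(** The rows of E are an orthonormal basis of eigenvectors of K, so that E *m w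
is the coordinate vector of w. *)
Section Coordinates.
Variables (R : realType) (d : nat) (K E : 'M[R]_d) (b : 'rV[R]_d).
Hypotheses (EET : E *m E^T = 1%:M) (EK : E *m K = diag_mx b *m E).

Lemma coord_eq0 (w : 'cV[R]_d) : (forall l, (E *m w) l 0 = 0) -> w = 0.
Proof.
move=> w0; rewrite -[w]mul1mx -(mulmx1C EET) -mulmxA.
by rewrite (_ : E *m w = 0) ?mulmx0 //; apply/colP => l; rewrite w0 mxE.
Qed.

Lemma coord_mul (w : 'cV[R]_d) l : (E *m (K *m w)) l 0 = b 0 l * (E *m w) l 0.
Proof. by rewrite mulmxA EK -mulmxA mul_diag_mx mxE. Qed.

(** A unit eigenvector for a simple eigenvalue is a basis vector up to sign, so
the projection onto it is a coordinate projection. *)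
Lemma coord_outer (v w : 'cV[R]_d) a l : dot v v = 1 -> K *m v = a *: v ->
  (forall l1 l2, b 0 l1 = a -> b 0 l2 = a -> l1 = l2) ->
  (E *m (dot v w *: v)) l 0 = (b 0 l == a)%:R * (E *m w) l 0.
Proof.
move=> v1 Kv simple; pose s := E *m v.
have s0 l' : b 0 l' != a -> s l' 0 = 0.
  move=> neq; have := coord_mul v l'; rewrite Kv -scalemxAr mxE -/s => /eqP.
  rewrite -subr_eq0 -mulrBl mulf_eq0 subr_eq0 [a == _]eq_sym (negPf neq) /=.
  by move/eqP.
have dotC_E (u : 'cV[R]_d) : dot v u = dot s (E *m u).
  by rewrite /dot /s trmx_mul mulmxA -[v^T *m _ *m _]mulmxA (mulmx1C EET) mulmx1.
rewrite -scalemxAr mxE -/s; case: eqVneq => [bl|/s0 ->]; last by rewrite mulr0 mul0r.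
have only (u : 'cV[R]_d) : dot v u = s l 0 * (E *m u) l 0.
  rewrite dotC_E dot_sum (bigD1 l) //= big1 ?addr0 // => l' neq.
  rewrite s0 ?mul0r //; apply: contraNneq neq => bl'.
  by apply/eqP/simple.
have := v1; rewrite only -/s => ss; rewrite mul1r only.
by rewrite mulrAC ss mul1r.
Qed.

Lemma char_poly_orthodiag : char_poly K = \prod_l ('X - (b 0 l)%:P).
Proof.
have nzX : ('X^d : {poly R}) != 0 by rewrite monic_neq0 ?monicXn.
apply: (mulfI nzX); rewrite -[in LHS](mul1mx K) -(mulmx1C EET) -mulmxA.
rewrite char_poly_mulmxC EK -mulmxA EET mulmx1 char_poly_trig; last first.
  by apply/diag_mx_is_trig.
by congr (_ * _); apply: eq_bigr => l _; rewrite mxE eqxx.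
Qed.

(** The powers of 'X account for the differing sizes of K and of the matrix
whose eigenvalues are listed by s; they only add zeros to the two lists. *)
Lemma perm_spectrum n (s : seq R) :
  'X^n * char_poly K = 'X^d * \prod_(a <- s) ('X - a%:P) ->
  perm_eq (nseq n 0 ++ [seq b 0 l | l : 'I_d]) (nseq d 0 ++ s).
Proof.
move=> charK; apply: prod_XsubC_eq; rewrite !big_cat /=.
have prod0 j : \prod_(a <- nseq j 0) ('X - a%:P) = 'X^j :> {poly R}.
  by rewrite big_nseq iter_mulr_1 polyC0 subr0.
by rewrite !prod0 -charK char_poly_orthodiag big_map big_enum.
Qed.

End Coordinates.

Lemma perm_simple (R : realType) (I J : finType) (F : I -> R) (b : J -> R) n d c :
  perm_eq (nseq n 0 ++ [seq b l | l : J]) (nseq d 0 ++ [seq F i | i : I]) ->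
  c != 0 -> (forall i i', F i = c -> F i' = c -> i = i') ->
  forall l l', b l = c -> b l' = c -> l = l'.
Proof.
move=> /permP/(_ (pred1 c)); rewrite !count_cat !count_nseq /= => E nzc simple.
move: E; rewrite eq_sym (negPf nzc) !mul0n !add0n !count_map.
rewrite -!enumT -!sum1_count !big_enum_cond => E l l' bl bl'.
have : (#|[pred l | b l == c]| <= 1)%N.
  rewrite -sum1_card E (sum1_card [pred i | F i == c]).
  by apply/card_le1_eqP => i i'; rewrite !inE => /eqP Fi /eqP Fi'; apply: simple.
by move/card_le1_eqP => le1; apply/esym/le1; rewrite inE ?bl ?bl' eqxx.
Qed.

Lemma perm_mem_nz (R : realType) (s t : seq R) n d c :
  perm_eq (nseq n 0 ++ s) (nseq d 0 ++ t) -> c \in s -> c != 0 -> c \in t.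
Proof.
move=> /perm_mem/(_ c); rewrite !mem_cat !mem_nseq => E cs nzc.
by move: E; rewrite cs (negPf nzc) !andbF /= => <-.
Qed.

(** * The projection onto the kernel of a transposed matrix *)

Section Projection.
Variables (R : realType) (d m : nat) (A : 'M[R]_(d, m)).

Definition proj_ker := 1%:M - A *m invmx (A^T *m A) *m A^T.

Lemma proj_ker_id (w : 'cV[R]_d) : A^T *m w = 0 -> proj_ker *m w = w.
Proof.
by move=> Aw; rewrite mulmxBl mul1mx -[_ *m A^T *m w]mulmxA Aw mulmx0 subr0.
Qed.

Lemma proj_ker_sym : proj_ker^T = proj_ker.
Proof.
rewrite /proj_ker linearB /= trmx1 !trmx_mul trmxK trmx_inv trmx_mul trmxK.
by rewrite mulmxA.
Qed.

Hypothesis unitA : A^T *m A \in unitmx.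

Lemma proj_kerA : proj_ker *m A = 0.
Proof. by rewrite mulmxBl mul1mx -!mulmxA mulVmx // mulmx1 subrr. Qed.

Lemma tr_proj_ker : A^T *m proj_ker = 0.
Proof. by rewrite -[LHS]trmxK trmx_mul trmxK proj_ker_sym proj_kerA trmx0. Qed.

Lemma proj_ker_idem : proj_ker *m proj_ker = proj_ker.
Proof.
rewrite {1}/proj_ker mulmxBl mul1mx -[_ *m A^T *m _]mulmxA.
by rewrite tr_proj_ker mulmx0 subr0.
Qed.

End Projection.

Lemma full_rank_gram (R : realType) d m (A : 'M[R]_(d, m)) :
  \rank A = m -> A^T *m A \in unitmx.
Proof.
move=> rA; rewrite -row_free_unit -kermx_eq0; apply/eqP/row_matrixP => i.
rewrite row0; set u := row i _.
have uAA : u *m (A^T *m A) = 0 by rewrite -row_mul mulmx_ker row0.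
have uA : A *m u^T = 0.
  apply/eqP; rewrite -dot_eq0 /dot trmx_mul trmxK -mulmxA [A^T *m _]mulmxA.
  by rewrite mulmxA uAA mul0mx mxE.
have : (u <= kermx A^T)%MS.
  by apply/sub_kermxP; rewrite -[LHS]trmxK trmx_mul trmxK uA trmx0.
have /eqP -> : kermx A^T == 0 by rewrite kermx_eq0 /row_free mxrank_tr rA.
by rewrite submx0 => /eqP.
Qed.

(** * Complex eigenvalues of real linear maps *)

(** The real and imaginary parts of a complex eigenvector. Working with the pair
keeps all later computations over the real numbers. *)
Lemma eigenvalue_lin_mxP (R : realType) p q
    (f : {linear 'M[R]_(p, q) -> 'M[R]_(p, q)}) (a : R[i]) :
  eigenvalue (map_mx (real_complex R) (lin_mx f)) a ->
  exists g h, [/\ (g != 0) || (h != 0),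
    f g = complex.Re a *: g - complex.Im a *: h &
    f h = complex.Im a *: g + complex.Re a *: h].
Proof.
case/eigenvalueP => Z ZJ nzZ.
pose g := map_mx (@complex.Re R) Z; pose h := map_mx (@complex.Im R) Z.
have defZ : Z = map_mx (real_complex R) g + 'i%C *: map_mx (real_complex R) h.
  by apply/rowP => j; rewrite !mxE [LHS]complexE.
have eqs : g *m lin_mx f = complex.Re a *: g - complex.Im a *: h /\
           h *m lin_mx f = complex.Im a *: g + complex.Re a *: h.
  move: ZJ; rewrite {1}defZ mulmxDl -scalemxAl -!map_mxM => ZJ.
  move: (g *m _) (h *m _) ZJ => gJ hJ ZJ.
  by split; apply/rowP => j; move/rowP/(_ j): ZJ; rewrite !mxE;
     case: a (Z 0 j) => [al be] [x y] /= [E1 E2]; lra.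
exists (vec_mx g), (vec_mx h); split.
- rewrite -negb_and; apply: contraNN nzZ => /andP[/eqP g0 /eqP h0].
  by rewrite defZ -[g]vec_mxK -[h]vec_mxK g0 h0 !linear0 !map_mx0 scaler0 addr0.
- by rewrite -mx_rV_lin eqs.1 linearB !linearZ.
- by rewrite -mx_rV_lin eqs.2 linearD !linearZ.
Qed.

Lemma real_eigenvalue_lin_mx (R : realType) p q
    (f : {linear 'M[R]_(p, q) -> 'M[R]_(p, q)}) (h : 'M[R]_(p, q)) a :
  h != 0 -> f h = a *: h ->
  eigenvalue (map_mx (real_complex R) (lin_mx f)) (real_complex R a).
Proof.
move=> nzh fh; apply/eigenvalueP; exists (map_mx (real_complex R) (mxvec h)).
  by rewrite -map_mxM mul_vec_lin fh linearZ map_mxZ.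
by rewrite map_mx_eq0 mxvec_eq0.
Qed.

Section Rotation.
Variables (R : realType).

(** The hypotheses are the real and imaginary parts of s z = - i t z for
z = x + i y. *)
Lemma rotation_eq0 (V : lmodType R) (s t : R) (x y : V) :
  0 < s -> s *: x = t *: y -> s *: y = - (t *: x) -> x = 0 /\ y = 0.
Proof.
move=> s_gt0 Ex Ey; have nz : s ^+ 2 + t ^+ 2 != 0.
  by rewrite gt_eqF // ltr_wpDr ?sqr_ge0 // exprn_gt0.
have kill (z : V) : s *: (s *: z) = - (t *: (t *: z)) -> z = 0.
  move/eqP; rewrite -subr_eq0 opprK !scalerA -scalerDl scaler_eq0 -!expr2.
  by rewrite (negPf nz) => /eqP.
split; apply: kill.
  by rewrite Ex scalerA mulrC -scalerA Ey scalerN.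
by rewrite Ey scalerN -Ex !scalerA mulrC.
Qed.

(** With z = al + i be and x = xp + i xq these are the equations r = z x and
- g r - c x = z r, that is, (z^2 + g z + c) x = 0; the factor does not vanish
for al >= 0. *)
Lemma damped_oscillator_eq0 (g c al be xp xq rp rq : R) :
  0 < g -> 0 < c -> 0 <= al ->
  rp = al * xp - be * xq -> rq = be * xp + al * xq ->
  - (g * rp) - c * xp = al * rp - be * rq ->
  - (g * rq) - c * xq = be * rp + al * rq -> xp = 0 /\ xq = 0.
Proof.
move=> g0 c0 al0 Erp Erq; rewrite Erp Erq => Ep Eq.
(* z^2 + g z + c = s + i t *)
pose s := (al + g) * al - be ^+ 2 + c; pose t := be * (2 * al + g).
have E1 : s * xp = t * xq by rewrite /s /t; lra.
have E2 : s * xq = - (t * xp) by rewrite /s /t; lra.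
have nz : s ^+ 2 + t ^+ 2 != 0.
  rewrite paddr_eq0 ?sqr_ge0 // !sqrf_eq0; apply/negP => /andP[/eqP s0 /eqP t0].
  move/eqP: t0; rewrite mulf_eq0 => /orP[/eqP be0|/eqP]; last by lra.
  by move: s0; rewrite /s be0; nra.
split; apply: (mulfI nz); rewrite mulr0.
  have -> : (s ^+ 2 + t ^+ 2) * xp = s * (s * xp) + t * (t * xp) by ring.
  by rewrite E1 -[t * xp]opprK -E2; ring.
have -> : (s ^+ 2 + t ^+ 2) * xq = s * (s * xq) + t * (t * xq) by ring.
by rewrite E2 -E1; ring.
Qed.
End Rotation.

(** * States *)

Section State.
Variables (R : realType) (d k : nat).
Implicit Types (p q : 'M[R]_(d, 1 + (1 + k))).

Lemma st_x_mk (x r : 'cV[R]_d) (v : 'I_k -> 'cV[R]_d) : st_x (mk_state x r v) = x.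
Proof. by rewrite /st_x row_mxKl. Qed.

Lemma st_r_mk (x r : 'cV[R]_d) (v : 'I_k -> 'cV[R]_d) : st_r (mk_state x r v) = r.
Proof. by rewrite /st_r row_mxKr row_mxKl. Qed.

Lemma st_v_mk (x r : 'cV[R]_d) (v : 'I_k -> 'cV[R]_d) i : st_v (mk_state x r v) i = v i.
Proof. by rewrite /st_v !row_mxKr; apply/colP => j; rewrite !mxE. Qed.

Lemma state_ext p q : st_x p = st_x q -> st_r p = st_r q ->
  (forall i, st_v p i = st_v q i) -> p = q.
Proof.
rewrite /st_x /st_r /st_v => Ex Er Ev; rewrite -[p]hsubmxK -[q]hsubmxK Ex.
congr row_mx; rewrite -[rsubmx p]hsubmxK -[rsubmx q]hsubmxK Er; congr row_mx.
apply/matrixP => j i; have /colP/(_ j) := Ev i; by rewrite !mxE.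
Qed.

Lemma st_x_lin a b p q : st_x (a *: p + b *: q) = a *: st_x p + b *: st_x q.
Proof. by rewrite /st_x linearD !linearZ. Qed.

Lemma st_r_lin a b p q : st_r (a *: p + b *: q) = a *: st_r p + b *: st_r q.
Proof. by rewrite /st_r !linearD !linearZ. Qed.

Lemma st_v_lin a b p q i : st_v (a *: p + b *: q) i = a *: st_v p i + b *: st_v q i.
Proof. by rewrite /st_v !linearD !linearZ. Qed.

Lemma st_xZ a p : st_x (a *: p) = a *: st_x p.
Proof. exact: linearZ. Qed.

Lemma st_rZ a p : st_r (a *: p) = a *: st_r p.
Proof. by rewrite /st_r !linearZ. Qed.

Lemma st_vZ a p i : st_v (a *: p) i = a *: st_v p i.
Proof. by rewrite /st_v !linearZ. Qed.

Lemma st_x0 : st_x (0 : 'M[R]_(d, 1 + (1 + k))) = 0.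
Proof. exact: linear0. Qed.

Lemma st_r0 : st_r (0 : 'M[R]_(d, 1 + (1 + k))) = 0.
Proof. by rewrite /st_r !linear0. Qed.

Lemma st_v0 i : st_v (0 : 'M[R]_(d, 1 + (1 + k))) i = 0.
Proof. by rewrite /st_v !linear0. Qed.

End State.

(** * Linearization of the deflated eigenvector equations *)

Section Deflation.
Variables (R : realType) (d k : nat) (K : 'M[R]_d) (v : 'I_k -> 'cV[R]_d).

(** The derivative in the direction w, with K constant, of the map sending the
frame v to - (1 - v_i v_i^T - 2 sum_(j < i) v_j v_j^T) K v_i. *)
Definition deflation_diff (w : 'I_k -> 'cV[R]_d) i : 'cV[R]_d :=
  (w i *m (v i)^T + v i *m (w i)^T
    + 2 *: \sum_(j < k | (j < i)%N) (w j *m (v j)^T + v j *m (w j)^T)) *m (K *m v i)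
  - (1%:M - v i *m (v i)^T - 2 *: \sum_(j < k | (j < i)%N) v j *m (v j)^T)
     *m (K *m w i).

Hypothesis symK : K^T = K.
Hypothesis v_on : forall i j, dot (v i) (v j) = (i == j)%:R.
Variable a : 'I_k -> R.
Hypothesis Kv : forall i, K *m v i = a i *: v i.

Lemma deflation_diffE w i : deflation_diff w i =
  a i *: w i - K *m w i + (2 * a i * dot (v i) (w i)) *: v i
  + 2 *: \sum_(j < k | (j < i)%N)
      (a j * dot (v j) (w i) + a i * dot (v i) (w j)) *: v j.
Proof.
have vKw j : dot (v j) (K *m w i) = a j * dot (v j) (w i).
  by rewrite dot_sym // Kv dotC dotZr dotC.
rewrite /deflation_diff !mulmxBl mul1mx mulmxDl -!scalemxAl mul_outer_sum.
rewrite [(w i *m _ + _) *m _]mulmxDl !mul_outer Kv !dotZr v_on eqxx mulr1 vKw.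
rewrite mulmx_suml.
have -> : \sum_(j < k | (j < i)%N) (w j *m (v j)^T + v j *m (w j)^T) *m (a i *: v i) =
    \sum_(j < k | (j < i)%N) (a i * dot (v i) (w j)) *: v j.
  apply: eq_bigr => j lt_ji; rewrite mulmxDl !mul_outer !dotZr v_on.
  by rewrite -(inj_eq val_inj) ltn_eqF // mulr0 scale0r add0r [dot (w j) _]dotC.
under [X in _ - (_ - 2 *: X)]eq_bigr do rewrite vKw.
under [in RHS]eq_bigr do rewrite scalerDl.
rewrite big_split /= scalerDr [dot (w i) _]dotC.
set X := 2 *: _; set Y := 2 *: _.
by apply/colP => j; rewrite !mxE; ring.
Qed.

(** Stretching v_i leaves the equations of the other v_l undisturbed, since v_i
is orthogonal to them. *)
Lemma deflation_diff_self i l :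
  deflation_diff (fun j => if j == i then v i else 0) l =
  (2 * a i) *: (if l == i then v i else 0).
Proof.
rewrite deflation_diffE; case: eqVneq => [->|neq].
  rewrite Kv v_on eqxx mulr1 subrr add0r big1 ?scaler0 ?addr0 // => j lt_ji.
  rewrite v_on -[j == i](inj_eq val_inj) ltn_eqF // !mulr0 dot0r mulr0.
  by rewrite addr0 scale0r.
rewrite !mulmx0 dot0r !(scaler0, mulr0, subr0, scale0r, add0r) big1 ?scaler0 // => j _.
rewrite dot0r mulr0 add0r; case: (j == i); last by rewrite dot0r mulr0 scale0r.
by rewrite v_on (negPf neq) mulr0 scale0r.
Qed.

(** The direction w rotates v_i and v_l in their plane. Without the deflation
term the rates at positions i and l would be a_i - a_l and a_l - a_i; at the
later position l that term adds 2 (a_i - a_l), so that the rates agree. *)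
Lemma deflation_diff_swap i l (w := fun j => if j == i then v l else
    if j == l then - v i else 0) j :
  (i < l)%N -> deflation_diff w j = (a i - a l) *: w j.
Proof.
move=> lt_il; have neq : i != l by rewrite -(inj_eq val_inj) ltn_eqF.
have wi : w i = v l by rewrite /w eqxx.
have wl : w l = - v i by rewrite /w [l == i]eq_sym (negPf neq) eqxx.
have w0 h : h != i -> h != l -> w h = 0.
  by rewrite /w => /negPf -> /negPf ->.
rewrite deflation_diffE; case: (eqVneq j i) => [->|ji].
  rewrite wi Kv v_on (negPf neq) mulr0 scale0r addr0 scalerBl big1 ?scaler0 ?addr0 //.
  move=> h lt_hi; have hi : h != i by rewrite -(inj_eq val_inj) ltn_eqF.
  have hl : h != l by rewrite -(inj_eq val_inj) ltn_eqF // (ltn_trans lt_hi).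
  by rewrite v_on (negPf hl) w0 // dot0r !mulr0 addr0 scale0r.
case: (eqVneq j l) => [->|jl].
  rewrite wl mulmxN Kv dotNr v_on [l == i]eq_sym (negPf neq) oppr0 mulr0 scale0r addr0.
  rewrite (bigD1 i) //= wi v_on eqxx big1 ?addr0 => [|h /andP[lt_hl hi]].
    rewrite dotNr v_on eqxx.
    by apply/colP => h; rewrite !mxE /= mulr1n; ring.
  have hl : h != l by rewrite -(inj_eq val_inj) ltn_eqF.
  by rewrite w0 // dotNr v_on (negPf hi) oppr0 dot0r !mulr0 addr0 scale0r.
rewrite (w0 j) // !mulmx0 dot0r !(scaler0, mulr0, subr0, scale0r, add0r).
rewrite big1 ?scaler0 // => h lt_hj; rewrite dot0r mulr0 add0r.
case: (eqVneq h i) => [->|hi]; first by rewrite wi v_on (negPf jl) mulr0 scale0r.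
case: (eqVneq h l) => [->|hl].
  by rewrite wl dotNr v_on (negPf ji) oppr0 mulr0 scale0r.
by rewrite w0 // dot0r mulr0 scale0r.
Qed.

End Deflation.

(** * Absence of unstable modes *)

(** D is the linearized system at a critical point: M is the derivative of the
Riemannian gradient, and K = M P. The rows of
E are an eigenbasis of K with eigenvalues b, and the v_i are the eigenvectors
for the negative eigenvalues a_1 < ... < a_k of K, all of them simple. *)
Section Decay.
Variables (R : realType) (d m k : nat) (A : 'M[R]_(d, m)) (M K E : 'M[R]_d).
Variables (b : 'rV[R]_d) (v : 'I_k -> 'cV[R]_d) (a : 'I_k -> R) (g1 g2 mu : R).
Variable D : 'M[R]_(d, 1 + (1 + k)) -> 'M[R]_(d, 1 + (1 + k)).
Local Notation P := (proj_ker A).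

Hypotheses (g1_gt0 : 0 < g1) (g2_gt0 : 0 < g2) (mu_gt0 : 0 < mu).
Hypothesis unitA : A^T *m A \in unitmx.
Hypotheses (symK : K^T = K) (PM : P *m M = M) (MP : M *m P = K).
Hypothesis kerK : forall w : 'cV[R]_d, P *m w = w -> K *m w = 0 -> w = 0.
Hypotheses (EET : E *m E^T = 1%:M) (EK : E *m K = diag_mx b *m E).
Hypothesis v_on : forall i j, dot (v i) (v j) = (i == j)%:R.
Hypothesis Kv : forall i, K *m v i = a i *: v i.
Hypothesis a_lt0 : forall i, a i < 0.
Hypothesis a_incr : forall i j : 'I_k, (i < j)%N -> a i < a j.
Hypothesis a_simple :
  forall i l1 l2, b 0 l1 = a i -> b 0 l2 = a i -> l1 = l2.
Hypothesis b_spec : forall l, b 0 l < 0 -> exists i, b 0 l = a i.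

Hypothesis D_x : forall h, st_x (D h) = st_r h - mu *: (A *m (A^T *m st_x h)).
Hypothesis D_r : forall h, st_r (D h) = - (g1 *: st_r h) -
  g2 *: ((1%:M - 2 *: \sum_i v i *m (v i)^T) *m (M *m st_x h)).
Hypothesis D_v : forall h, st_x h = 0 -> st_r h = 0 ->
  forall i, st_v (D h) i = deflation_diff K v (st_v h) i.

Let PK : P *m K = K. Proof. by rewrite -MP mulmxA PM. Qed.

Let KP : K *m P = K.
Proof. by rewrite -MP -mulmxA proj_ker_idem. Qed.

Let Pv i : P *m v i = v i.
Proof.
have nz : a i != 0 by rewrite lt_eqF.
by apply: (scalerI nz); rewrite scalemxAr -Kv mulmxA PK.
Qed.

Let a_inj i j : a i = a j -> i = j.
Proof.
move=> Ea; case: (ltngtP i j) => [/a_incr|/a_incr|/val_inj //]; by rewrite Ea ltxx.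
Qed.

Let coord_v i w l :
  (E *m (dot (v i) w *: v i)) l 0 = (b 0 l == a i)%:R * (E *m w) l 0.
Proof.
apply: coord_outer (EET) (EK) _ _ _ _ _ (Kv i) _; first by rewrite v_on eqxx.
exact: a_simple.
Qed.

(** The i-th diagonal block of the Jacobian is diagonal in the eigenbasis; these
are its entries. *)
Let stage_coef (i : 'I_k) l := a i - b 0 l + 2 * a i * (b 0 l == a i)%:R
  + 2 * \sum_(j < k | (j < i)%N) a j * (b 0 l == a j)%:R.

(** The l-th entry is a_j + a_i if b_l = a_j with j <= i, it is a_i - a_j if
b_l = a_j with j > i, and it is a_i - b_l if b_l >= 0. *)
Let stage_coef_lt0 i l : stage_coef i l < 0.
Proof.
have := a_lt0 i; rewrite /stage_coef; case: (ltP (b 0 l) 0) => [/b_spec[j bl]|b_ge0].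
  have := a_lt0 j; rewrite bl.
  have sum1 (j' : 'I_k) : j' != j -> a j' * (a j == a j')%:R = 0.
    move=> neq; rewrite (_ : _ == _ = false) ?mulr0 //.
    by apply: contraNF neq => /eqP/a_inj ->.
  case: (ltngtP j i) => [lt_ji|lt_ij|/val_inj <-].
  - rewrite (bigD1 j) //= eqxx big1 => [|j' /andP[_ /sum1] //].
    rewrite (_ : a j == a i = false) /=; last first.
      by apply/negbTE; rewrite lt_eqF // a_incr.
    by rewrite mulr0 !addr0 mulr1; lra.
  - rewrite (_ : a j == a i = false) /=; last first.
      by apply/negbTE; rewrite gt_eqF // a_incr.
    rewrite big1 => [|j' lt_j'i]; first by have := a_incr lt_ij; lra.
    by rewrite sum1 // -(inj_eq val_inj) ltn_eqF // (ltn_trans lt_j'i).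
  - rewrite eqxx big1 => [|j' lt_j'i]; first by rewrite /=; lra.
    by rewrite sum1 // -(inj_eq val_inj) ltn_eqF.
have nb (j : 'I_k) : (b 0 l == a j) = false.
  by apply/negbTE; rewrite gt_eqF // (lt_le_trans (a_lt0 j)).
rewrite nb big1 => [|j _]; first by rewrite mulr0n; lra.
by rewrite nb mulr0.
Qed.

Let coord_stage (w : 'I_k -> 'cV[R]_d) (i : 'I_k) l :
  (forall j : 'I_k, (j < i)%N -> w j = 0) ->
  (E *m deflation_diff K v w i) l 0 = stage_coef i l * (E *m w i) l 0.
Proof.
move=> w0; rewrite (deflation_diffE symK v_on Kv).
rewrite (eq_bigr (fun j => a j *: (dot (v j) (w i) *: v j))); last first.
  by move=> j /w0 ->; rewrite dot0r mulr0 addr0 scalerA.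
rewrite -scalerA; move: (coord_v i (w i) l); move: (dot _ _ *: v i) => X EX.
set Y := \sum_(j < k | _) _.
have EY : (E *m Y) l 0 =
    (\sum_(j < k | (j < i)%N) a j * (b 0 l == a j)%:R) * (E *m w i) l 0.
  rewrite /Y mulmx_sumr summxE mulr_suml; apply: eq_bigr => j _.
  by rewrite -scalemxAr mxE coord_v mulrA.
move: Y EY (coord_mul EK (w i) l) => Y EY EKw; rewrite /stage_coef.
rewrite !mulmxDr mulmxN -!scalemxAr.
move: (E *m X) (E *m Y) (E *m (K *m w i)) EX EY EKw => X' Y' Z' EX EY EKw.
by rewrite !mxE in EX EY EKw *; rewrite EX EY EKw; ring.
Qed.

Let S : 'M[R]_d := 1%:M - 2 *: \sum_i v i *m (v i)^T.

Let SE (w : 'cV[R]_d) : S *m w = w - 2 *: \sum_i dot (v i) w *: v i.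
Proof. by rewrite mulmxBl mul1mx -scalemxAl mul_outer_sum. Qed.

Let PS (w : 'cV[R]_d) : P *m w = w -> P *m (S *m w) = S *m w.
Proof.
move=> Pw; rewrite SE mulmxBr Pw -scalemxAr mulmx_sumr; congr (_ - 2 *: _).
by apply: eq_bigr => i _; rewrite -scalemxAr Pv.
Qed.

(** Reflecting the eigenvectors of the negative eigenvalues turns K into its
absolute value, so c = |b_l|. *)
Let coord_S l : exists2 c : R, (b 0 l != 0 -> 0 < c) &
  forall w : 'cV[R]_d, (E *m (S *m (K *m w))) l 0 = c * (E *m w) l 0.
Proof.
exists (b 0 l - 2 * (\sum_i (b 0 l == a i)%:R) * b 0 l).
  case: (ltgtP (b 0 l) 0) => // [b_lt0 _|b_gt0 _].
    have [i bi] := b_spec b_lt0; rewrite (bigD1 i) //= bi eqxx big1 => [|j neq].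
      by rewrite -bi /=; lra.
    rewrite (_ : _ == _ = false) //.
    by apply: contraNF neq => /eqP/a_inj ->.
  rewrite big1 => [|j _]; first by lra.
  by rewrite gt_eqF // (lt_trans (a_lt0 j)).
move=> w; rewrite SE mulmxBr -scalemxAr mulmx_sumr.
have ES : (\sum_i E *m (dot (v i) (K *m w) *: v i)) l 0 =
    (\sum_i (b 0 l == a i)%:R) * (b 0 l * (E *m w) l 0).
  rewrite summxE mulr_suml; apply: eq_bigr => i _.
  by rewrite coord_v (coord_mul EK).
move: (\sum_i E *m _) (E *m (K *m w)) (E *m w) ES (coord_mul EK w l) => Y Z W ES Kl.
by rewrite !mxE Kl ES; ring.
Qed.

(** The projection of the basis vector is a tangent vector in the kernel of K,
hence zero. *)
Let coord_ker l (w : 'cV[R]_d) : b 0 l = 0 -> P *m w = w -> (E *m w) l 0 = 0.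
Proof.
move=> bl0 Pw; pose e := (row l E)^T.
have dot_e (u : 'cV[R]_d) : (E *m u) l 0 = dot e u.
  by rewrite /dot /e trmxK -row_mul [RHS]mxE.
have Ke : K *m e = 0.
  apply: trmx_inj; rewrite trmx_mul symK trmx0 /e trmxK -row_mul EK row_mul.
  by rewrite row_diag_mx bl0 scale0r mul0mx.
rewrite dot_e -Pw (dot_sym _ _ (proj_ker_sym A)).
rewrite (kerK (w := P *m e)) ?mulmxA ?proj_ker_idem ?KP //.
by rewrite dotC dot0r.
Qed.

(** The pair (p, q) stands for the complex eigenvector p + i q with eigenvalue
al + i be. *)
Lemma no_unstable_pair p q al be : 0 <= al ->
  D p = al *: p - be *: q -> D q = be *: p + al *: q -> p = 0 /\ q = 0.
Proof.
move=> al_ge0; rewrite -scaleNr => Dp Dq.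
(* The normal part of r satisfies a closed equation with rate - g1. *)
pose nr (h : 'M[R]_(d, 1 + (1 + k))) := st_r h - P *m st_r h.
have nrD h : nr (D h) = - (g1 *: nr h).
  rewrite /nr D_r mulmxBr mulmxN -!scalemxAr -/S PS; last by rewrite mulmxA PM.
  by apply/colP => j; rewrite !mxE; ring.
have nr_lin x y (h h' : 'M[R]_(d, 1 + (1 + k))) :
    nr (x *: h + y *: h') = x *: nr h + y *: nr h'.
  by rewrite /nr st_r_lin mulmxDr -!scalemxAr opprD addrACA -!scalerBr.
have [nrp nrq] : nr p = 0 /\ nr q = 0.
  have Ep := nrD p; have Eq := nrD q; rewrite Dp Dq !nr_lin in Ep Eq.
  move: (nr p) (nr q) Ep Eq => y z Ep Eq.
  apply: (@rotation_eq0 _ _ (al + g1) be); first by rewrite ltr_wpDl.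
    by apply/colP => j; have /colP/(_ j) := Ep; rewrite !mxE; lra.
  by apply/colP => j; have /colP/(_ j) := Eq; rewrite !mxE; lra.
have {nrD nr_lin} Ar h : nr h = 0 -> A^T *m st_r h = 0.
  by move/eqP; rewrite subr_eq0 => /eqP ->; rewrite mulmxA tr_proj_ker // mul0mx.
have Arp := Ar p nrp; have Arq := Ar q nrq.
(* Once r is tangent, A^T x evolves by - mu A^T A, which is negative definite. *)
have [Axp Axq] : A^T *m st_x p = 0 /\ A^T *m st_x q = 0.
  have Ep := congr1 (fun h => A^T *m st_x h) Dp.
  have Eq := congr1 (fun h => A^T *m st_x h) Dq.
  rewrite /= !D_x !st_x_lin !mulmxDr !mulmxN -!scalemxAr Arp Arq !add0r in Ep Eq.
  move: (A^T *m st_x p) (A^T *m st_x q) Ep Eq => y z Ep Eq.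
  have dA (u : 'cV[R]_m) : dot u (A^T *m (A *m u)) = dot (A *m u) (A *m u).
    by rewrite dot_adj trmxK.
  have := congr1 (dot y) Ep; have := congr1 (dot z) Eq.
  rewrite !dotNr !dotDr !dotZr !dA [dot z y]dotC => Ez Ey.
  have [Ay0 Az0] : dot (A *m y) (A *m y) = 0 /\ dot (A *m z) (A *m z) = 0.
    have Ay := dot_ge0 (A *m y); have Az := dot_ge0 (A *m z).
    have aly := mulr_ge0 al_ge0 (dot_ge0 y); have alz := mulr_ge0 al_ge0 (dot_ge0 z).
    have : mu * (dot (A *m y) (A *m y) + dot (A *m z) (A *m z)) <= 0 by lra.
    by rewrite pmulr_rle0 // => le0; split; lra.
  have A0 (u : 'cV[R]_m) : dot (A *m u) (A *m u) = 0 -> u = 0.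
    move/eqP; rewrite dot_eq0 => /eqP Au.
    by rewrite -[u](mulKmx unitA) -mulmxA Au !mulmx0.
  by split; [exact: A0 Ay0 | exact: A0 Az0].
have Pxp := proj_ker_id Axp; have Pxq := proj_ker_id Axq.
(* What is left of (x, r) is tangent: one damped oscillator per eigenvector. *)
have Erp : st_r p = al *: st_x p + - be *: st_x q.
  by have := congr1 (@st_x _ _ _) Dp; rewrite D_x Axp mulmx0 scaler0 subr0 st_x_lin.
have Erq : st_r q = be *: st_x p + al *: st_x q.
  by have := congr1 (@st_x _ _ _) Dq; rewrite D_x Axq mulmx0 scaler0 subr0 st_x_lin.
have [xp0 xq0] : st_x p = 0 /\ st_x q = 0.
  suff X0 l : (E *m st_x p) l 0 = 0 /\ (E *m st_x q) l 0 = 0.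
    by split; apply: (coord_eq0 EET) => l; case: (X0 l).
  have [bl0|nz_bl] := eqVneq (b 0 l) 0; first by rewrite !coord_ker.
  have [c /(_ nz_bl) c_gt0 cS] := coord_S l.
  have MK (w : 'cV[R]_d) : P *m w = w -> M *m w = K *m w.
    by move=> Pw; rewrite -{1}Pw mulmxA MP.
  have coordr (y z t : 'cV[R]_d) s1 s2 : y = s1 *: z + s2 *: t ->
      (E *m y) l 0 = s1 * (E *m z) l 0 + s2 * (E *m t) l 0.
    by move=> ->; rewrite mulmxDr -!scalemxAr !mxE.
  have Crp := coordr _ _ _ _ _ Erp; have Crq := coordr _ _ _ _ _ Erq.
  have Dr h h1 h2 s1 s2 : P *m st_x h = st_x h -> D h = s1 *: h1 + s2 *: h2 ->
      - (g1 * (E *m st_r h) l 0) - g2 * c * (E *m st_x h) l 0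
      = s1 * (E *m st_r h1) l 0 + s2 * (E *m st_r h2) l 0.
    move=> Ph Dh; rewrite -(coordr (st_r (D h))); last by rewrite Dh st_r_lin.
    rewrite D_r MK // mulmxBr mulmxN -!scalemxAr -/S -mulrA -cS.
    by rewrite [RHS]mxE; congr (_ + _); rewrite !mxE.
  apply: (@damped_oscillator_eq0 _ g1 (g2 * c) al be _ _
    ((E *m st_r p) l 0) ((E *m st_r q) l 0)) => //.
  - exact: mulr_gt0.
  - by rewrite Crp mulNr.
  - by rewrite (Dr _ _ _ _ _ Pxp Dp) mulNr.
  - by rewrite (Dr _ _ _ _ _ Pxq Dq).
have rp0 : st_r p = 0 by rewrite Erp xp0 xq0 !scaler0 addr0.
have rq0 : st_r q = 0 by rewrite Erq xp0 xq0 !scaler0 addr0.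
(* With (x, r) = 0 the frame equations are triangular in the v_i. *)
have vs : forall n (i : 'I_k), (i < n)%N -> st_v p i = 0 /\ st_v q i = 0.
  elim=> // n IHn i; rewrite ltnS => le_in.
  have IH (j : 'I_k) : (j < i)%N -> st_v p j = 0 /\ st_v q j = 0.
    by move=> lt_ji; apply: IHn; apply: leq_trans lt_ji le_in.
  suff V0 l : (E *m st_v p i) l 0 = 0 /\ (E *m st_v q i) l 0 = 0.
    by split; apply: (coord_eq0 EET) => l; case: (V0 l).
  have coordv h h1 h2 s1 s2 : st_x h = 0 -> st_r h = 0 ->
      (forall j : 'I_k, (j < i)%N -> st_v h j = 0) -> D h = s1 *: h1 + s2 *: h2 ->
      stage_coef i l * (E *m st_v h i) l 0
      = s1 * (E *m st_v h1 i) l 0 + s2 * (E *m st_v h2 i) l 0.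
    move=> hx hr hv Dh; rewrite -coord_stage // -D_v // Dh st_v_lin.
    by rewrite mulmxDr -!scalemxAr !mxE.
  have Ep := coordv _ _ _ _ _ xp0 rp0 (fun j lt => (IH j lt).1) Dp.
  have Eq := coordv _ _ _ _ _ xq0 rq0 (fun j lt => (IH j lt).2) Dq.
  apply: (@rotation_eq0 _ R^o (al - stage_coef i l) be).
  - by rewrite subr_gt0 (lt_le_trans (stage_coef_lt0 i l)).
  - by rewrite /GRing.scale /=; lra.
  - by rewrite /GRing.scale /=; lra.
split; apply: state_ext; rewrite ?xp0 ?rp0 ?xq0 ?rq0 /st_x /st_r /st_v ?linear0 //.
  by move=> i; rewrite !linear0; case: (vs i.+1 i (ltnSn i)).
by move=> i; rewrite !linear0; case: (vs i.+1 i (ltnSn i)).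
Qed.

End Decay.

(** * Symmetry of second derivatives *)

Section Calculus.
Variables (R : realType).

Lemma diff_remainder (V W : normedModType R) (f : V -> W) x (e : R) :
  differentiable f x -> 0 < e ->
  exists2 r : R, 0 < r & forall h, `|h| < r ->
    `|f (h + x) - f x - 'd f x h| <= e * `|h|.
Proof.
move=> /diff_locally fx e_gt0.
have /eqaddoP/(_ e e_gt0) := fx.
move=> /nbhs_ballP[r /= r_gt0 rP]; exists r => // h hr.
have := rP h; rewrite -ball_normE /= sub0r normrN => /(_ hr).
by rewrite opprD addrA.
Qed.

Lemma near_differentiable (V W : normedModType R) (f g : V -> W) x :
  (\near x, f x = g x) -> differentiable g x -> differentiable f x.
Proof.
move=> fg gx; have fxgx := nbhs_singleton fg.
have fo : f \o shift x = cst (f x) + 'd g x +o_ (0 : V) id.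
  have /diff_locally gxo := gx.
  apply/eqaddoP => e e_gt0; have /eqaddoP/(_ e e_gt0) := gxo.
  move=> H; have {}fg : \forall h \near (0 : V), f (h + x) = g (h + x).
    by move: fg; rewrite (near_shift 0 x) subr0.
  apply: filterS2 fg H => h /= fh.
  by rewrite -[(f \o shift x - _) h]/(f (h + x) - (f x + 'd g x h)) fh fxgx.
apply/diff_locallyP; have dfg := diff_unique (diff_continuous gx) fo.
by rewrite dfg; split; first exact: diff_continuous.
Qed.

(** By the mean value theorem in the direction u the second difference is h
times an increment of 'D_u g over h *: w, and the differentiability of 'D_u g
at x evaluates that increment up to o(h). *)
Lemma mixed_second_difference (V : normedModType R) (g : V -> R) (u w x : V) (e : R) :
  (forall y, differentiable g y) -> differentiable ('D_u g) x -> 0 < e ->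
  exists2 r : R, 0 < r & forall h, 0 < h < r ->
    `|g (h *: u + (h *: w + x)) - g (h *: u + x) - g (h *: w + x) + g x
      - h ^+ 2 * 'D_w ('D_u g) x| <= e * h ^+ 2.
Proof.
move=> dg dp e_gt0; set p := 'D_u g in dp *.
(* N * h bounds the norm of all points s *: u + h *: w with 0 < s < h. *)
pose N := `|u| + `|w| + 1.
have N_gt0 : 0 < N by rewrite ltr_pwDr // addr_ge0.
pose e' := e / (N + N); have e'_gt0 : 0 < e' by rewrite divr_gt0 // addr_gt0.
have [r r_gt0 rP] := diff_remainder dp e'_gt0.
exists (r / N) => [|h /andP[h_gt0 hr]]; first by rewrite divr_gt0.
pose phi t := g (t *: u + (h *: w + x)) - g (t *: u + x).
have dline (y : V) (t : R) : is_derive t (1 : R) (fun t : R => g (t *: u + y)) (p (t *: u + y)).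
  have ex : derivable g (t *: u + y) u by exact: diff_derivable.
  have E : (fun s : R => s^-1 *: (((fun t0 => g (t0 *: u + y)) \o shift t) (s *: 1) -
      g (t *: u + y))) =
     (fun s : R => s^-1 *: ((g \o shift (t *: u + y)) (s *: u) - g (t *: u + y))).
    by apply/funext => s /=; rewrite [s *: 1]mulr1 scalerDl addrA.
  by split; rewrite /derivable /derive E.
have dphi (t : R) : is_derive t (1 : R) phi (p (t *: u + (h *: w + x)) - p (t *: u + x)).
  exact: is_deriveB.
have [|s] := @MVT R phi _ 0 h h_gt0 (fun t _ => dphi t).
  apply: continuous_subspaceT => t; apply: differentiable_continuous.
  by apply/derivable1_diffP; have [] := dphi t.
rewrite in_itv /= subr0 => /andP[s_gt0 sh].
rewrite {1 2}/phi !scale0r !add0r => Ephi.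
have hN (y : V) (c : R) : `|y| <= c * h -> c <= N -> `|y| < r.
  move=> yc cN; apply: le_lt_trans yc _; rewrite ltr_pdivlMr // in hr.
  by apply: le_lt_trans hr; rewrite mulrC ler_pM2l.
have nu : `|s *: u| <= `|u| * h.
  by rewrite normrZ gtr0_norm // mulrC ler_wpM2l // ltW.
have nw : `|s *: u + h *: w| <= (`|u| + `|w|) * h.
  rewrite (le_trans (ler_normD _ _)) // mulrDl lerD //.
  by rewrite normrZ gtr0_norm // mulrC.
have B1 := rP _ (hN _ _ nu _); have B2 := rP _ (hN _ _ nw _).
have {B1} B1 : `|p (s *: u + x) - p x - 'd p x (s *: u)| <= e' * (N * h).
  apply: le_trans (B1 _) _; first by rewrite /N -addrA lerDl addr_ge0.
  rewrite ler_pM2l // (le_trans nu) // ler_pM2r // /N -addrA lerDl addr_ge0 //.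
have {B2} B2 : `|p (s *: u + h *: w + x) - p x - 'd p x (s *: u + h *: w)| <= e' * (N * h).
  apply: le_trans (B2 _) _; first by rewrite /N lerDl.
  by rewrite ler_pM2l // (le_trans nw) // ler_pM2r // /N lerDl.
have Dw : 'D_w p x = 'd p x w by rewrite deriveE.
have dlin : 'd p x (s *: u + h *: w) = 'd p x (s *: u) + h * 'd p x w.
  by rewrite linearD [X in _ + X]linearZ.
set T := _ + g x - _.
have -> : T = h * ((p (s *: u + h *: w + x) - p x - 'd p x (s *: u + h *: w)) -
   (p (s *: u + x) - p x - 'd p x (s *: u))).
  rewrite /T dlin -/p Dw -addrA; move: Ephi; rewrite -[s *: u + h *: w + x]addrA.
  set a := g _; set b := g _; set c := g _; set d := g _ => Ephi.
  have -> : a - b - c + (d - h ^+ 2 * 'd p x w) = (a - b - (c - d)) - h ^+ 2 * 'd p x w by ring.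
  by rewrite Ephi; ring.
rewrite normrM gtr0_norm // expr2 mulrCA ler_pM2l //.
apply: le_trans (ler_normB _ _) _; apply: le_trans (lerD B2 B1) _.
rewrite -mulrDr -mulrDl mulrA /e' divfK //.
by rewrite gt_eqF // addr_gt0.
Qed.

(** The second difference is symmetric in u and w, so both iterated derivatives
are its limit after division by h^2. *)
Theorem derive_mixedC (V : normedModType R) (g : V -> R) (u w x : V) :
  (forall y, differentiable g y) -> differentiable ('D_u g) x ->
  differentiable ('D_w g) x -> 'D_w ('D_u g) x = 'D_u ('D_w g) x.
Proof.
move=> dg du dw; apply/eqP; rewrite -subr_eq0 -normr_eq0 eq_le normr_ge0 andbT.
apply/ler_addgt0Pl => e e_gt0; rewrite addr0.
have e2 : 0 < e / 2 by rewrite divr_gt0.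
have [r1 r1_gt0 H1] := mixed_second_difference w dg du e2.
have [r2 r2_gt0 H2] := mixed_second_difference u dg dw e2.
pose h := Num.min r1 r2 / 2.
have h_gt0 : 0 < h by rewrite divr_gt0 // lt_min r1_gt0.
have hm : h < Num.min r1 r2 by rewrite /h; have := h_gt0; rewrite /h; lra.
have {}H1 := H1 h; have {}H2 := H2 h.
move: hm; rewrite lt_min => /andP[hr1 hr2].
rewrite h_gt0 hr1 in H1; rewrite h_gt0 hr2 in H2.
have {}H1 := H1 isT; have {}H2 := H2 isT.
have h2 : 0 < h ^+ 2 by rewrite exprn_gt0.
rewrite -(ler_pM2l h2); rewrite -[X in X * `|_|]gtr0_norm // -normrM.
have -> : h ^+ 2 * e = e / 2 * h ^+ 2 + e / 2 * h ^+ 2 by field.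
apply: le_trans (lerD H2 H1); apply: le_trans (ler_normB _ _).
rewrite [h *: w + (h *: u + x)]addrCA le_eqVlt; apply/orP; left; apply/eqP.
move: ('D_w ('D_u g) x) ('D_u ('D_w g) x) (g x) => D1 D2 g0.
move: (g (h *: u + (h *: w + x))) (g (h *: u + x)) (g (h *: w + x)) => g1 g2 g3.
by congr (`|_|); ring.
Qed.

End Calculus.

(** * Differentiation of matrix-valued maps *)

Section Tools.
Variables (R : realType) (V : normedModType R).

Lemma differentiable_big (W : normedModType R) (I : Type) (s : seq I) (Q : pred I)
    (F : I -> V -> W) x :
  (forall i, Q i -> differentiable (F i) x) ->
  differentiable (fun y => \sum_(i <- s | Q i) F i y) x.
Proof.
move=> dF; elim: s => [|i s IHs].
  under eq_fun do rewrite big_nil; exact: differentiable_cst.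
under eq_fun do rewrite big_cons.
case Qi: (Q i) => //; exact: differentiableD (dF i Qi) IHs.
Qed.

Lemma differentiable_bigprod (I : Type) (s : seq I) (Q : pred I)
    (F : I -> V -> R) x :
  (forall i, Q i -> differentiable (F i) x) ->
  differentiable (fun y => \prod_(i <- s | Q i) F i y) x.
Proof.
move=> dF; elim: s => [|i s IHs].
  under eq_fun do rewrite big_nil; exact: differentiable_cst.
under eq_fun do rewrite big_cons.
case Qi: (Q i) => //; exact: differentiableM (dF i Qi) IHs.
Qed.

Lemma mx_differentiable m n (F : V -> 'M[R]_(m, n)) x :
  (forall i j, differentiable (fun y => F y i j) x) -> differentiable F x.
Proof.
move=> dF; rewrite (_ : F = fun y => \sum_i \sum_j F y i j *: delta_mx i j); last first.
  by apply/funext => y; exact: matrix_sum_delta.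
apply: differentiable_big => i _; apply: differentiable_big => j _.
exact: differentiableZl.
Qed.

Lemma differentiable_entry m n (F : V -> 'M[R]_(m, n)) x i j :
  differentiable F x -> differentiable (fun y => F y i j) x.
Proof.
move=> dF; apply: (@differentiable_comp _ _ _ _ F (fun M : 'M[R]_(m, n) => M i j)) => //.
exact: differentiable_coord.
Qed.

Lemma differentiable_mulmx m n p (F : V -> 'M[R]_(m, n)) (G : V -> 'M[R]_(n, p)) x :
  differentiable F x -> differentiable G x ->
  differentiable (fun y => F y *m G y) x.
Proof.
move=> dF dG; apply: mx_differentiable => i j.
under eq_fun do rewrite mxE.
apply: differentiable_big => l _; apply: differentiableM; exact: differentiable_entry.
Qed.

Lemma differentiable_trmx m n (F : V -> 'M[R]_(m, n)) x :
  differentiable F x -> differentiable (fun y => (F y)^T) x.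
Proof.
move=> dF; apply: mx_differentiable => i j.
by under eq_fun do rewrite mxE; exact: differentiable_entry.
Qed.

Lemma differentiable_det n (F : V -> 'M[R]_n) x :
  (forall i j, differentiable (fun y => F y i j) x) ->
  differentiable (fun y => \det (F y)) x.
Proof.
move=> dF; rewrite /determinant; apply: differentiable_big => s _.
apply: differentiableM; first exact: differentiable_cst.
by apply: differentiable_bigprod => i _; exact: dF.
Qed.

Lemma near_unitmx n (F : V -> 'M[R]_n) x :
  differentiable F x -> F x \in unitmx -> \near x, F x \in unitmx.
Proof.
move=> dF uF; have /differentiable_continuous detc : differentiable (fun y => \det (F y)) x.
  by apply: differentiable_det => i j; exact: differentiable_entry.
have nz : \det (F x) != 0 by rewrite -unitfE.
near=> y; rewrite unitmxE unitfE.
by near: y; exact: cvgr_neq0 detc nz.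
Unshelve. all: by end_near.
Qed.

(** Near x the inverse is given by the adjugate formula, which is rational in the
entries. *)
Lemma differentiable_invmx n (F : V -> 'M[R]_n) x :
  differentiable F x -> F x \in unitmx -> differentiable (fun y => invmx (F y)) x.
Proof.
move=> dF uF; have nz : \det (F x) != 0 by rewrite -unitfE.
apply: (@near_differentiable _ _ _ _ (fun y => (\det (F y))^-1 *: \adj (F y))).
  by near=> y; rewrite /invmx (near (near_unitmx dF uF) y).
apply: mx_differentiable => i j; under eq_fun do rewrite !mxE.
have dFij i' j' : differentiable (fun y => F y i' j') x by exact: differentiable_entry.
apply: differentiableM.
  by apply: differentiableV => //; exact: differentiable_det.
apply: differentiableM; first exact: differentiable_cst.
apply: differentiable_det => i' j'; under eq_fun do rewrite !mxE; exact: dFij.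
Unshelve. all: by end_near. Qed.

Lemma is_derive_big (W : normedModType R) (I : Type) (s : seq I) (Q : pred I)
    (F : I -> V -> W) (dF : I -> W) (x h : V) :
  (forall i, Q i -> is_derive x h (F i) (dF i)) ->
  is_derive x h (fun y => \sum_(i <- s | Q i) F i y) (\sum_(i <- s | Q i) dF i).
Proof.
move=> HF; elim: s => [|i s IHs].
  under eq_fun do rewrite big_nil; rewrite big_nil; exact: is_derive_cst.
under eq_fun do rewrite big_cons; rewrite big_cons.
case Qi: (Q i) => //; have := HF i Qi => Fi; exact: is_deriveD.
Qed.

Lemma is_derive_mxP m n (F : V -> 'M[R]_(m, n)) (dF : 'M[R]_(m, n)) (x h : V) :
  is_derive x h F dF <-> forall i j, is_derive x h (fun y => F y i j) (dF i j).
Proof.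
split=> [[ex <-] i j|H].
  by split; [apply: (derivable_mxP _ _ _).1|rewrite derive_mx // mxE].
have ex : derivable F x h by apply/derivable_mxP => i j; case: (H i j).
split=> //; rewrite derive_mx //; apply/matrixP => i j; rewrite mxE.
by case: (H i j).
Qed.

Lemma is_derive_mulmx m n p (F : V -> 'M[R]_(m, n)) (G : V -> 'M[R]_(n, p)) dF dG
    (x h : V) :
  is_derive x h F dF -> is_derive x h G dG ->
  is_derive x h (fun y => F y *m G y) (dF *m G x + F x *m dG).
Proof.
move=> /is_derive_mxP HF /is_derive_mxP HG; apply/is_derive_mxP => i j.
under eq_fun do rewrite mxE.
rewrite !mxE -big_split /=; apply: is_derive_big => l _.
have := HF i l; have := HG l j => HGl HFl.
by apply: is_derive_eq; rewrite /GRing.scale /= addrC; congr (_ + _); rewrite mulrC.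
Qed.

Lemma is_derive_trmx m n (F : V -> 'M[R]_(m, n)) dF (x h : V) :
  is_derive x h F dF -> is_derive x h (fun y => (F y)^T) dF^T.
Proof.
move=> /is_derive_mxP HF; apply/is_derive_mxP => i j.
by rewrite mxE; under eq_fun do rewrite mxE.
Qed.

Lemma diff_is_derive (W : normedModType R) (F : V -> W) (x h : V) :
  differentiable F x -> is_derive x h F ('d F x h).
Proof. by move=> dF; split; [exact: diff_derivable|exact: deriveE]. Qed.

(** A directional derivative only sees the values along a line, so f may be
replaced by any map, on any space, that has the same values there. *)
Lemma is_derive_line (V' W : normedModType R) (f : V -> W) (g : V' -> W)
    (x h : V) (x' h' : V') dg :
  (forall t : R, f (t *: h + x) = g (t *: h' + x')) ->
  is_derive x' h' g dg -> is_derive x h f dg.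
Proof.
move=> fg [ex <-]; have fgx : f x = g x'.
  by have := fg 0; rewrite !scale0r !add0r.
have E : (fun t : R => t^-1 *: ((f \o shift x) (t *: h) - f x)) =
    (fun t : R => t^-1 *: ((g \o shift x') (t *: h') - g x')).
  by apply/funext => t /=; rewrite fg fgx.
by split; rewrite /derivable /derive E.
Qed.

End Tools.

Section Smooth.
Variables (R : realType) (d : nat) (g : 'cV[R]_d -> R).
Hypothesis g_smooth : smooth g.

Lemma smooth_differentiable x : differentiable g x.
Proof. exact: (g_smooth [::]). Qed.

Lemma gradient_differentiable x : differentiable (gradient g) x.
Proof.
apply: mx_differentiable => i j; under eq_fun do rewrite mxE.
exact: (g_smooth [:: i]).
Qed.

Lemma hessian_differentiable x : differentiable (hessian g) x.
Proof.
apply: mx_differentiable => i j; under eq_fun do rewrite mxE.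
exact: (g_smooth [:: j; i]).
Qed.

Lemma hessian_sym x : (hessian g x)^T = hessian g x.
Proof.
apply/matrixP => i j; rewrite !mxE /partial; apply: derive_mixedC.
- exact: smooth_differentiable.
- exact: (g_smooth [:: j]).
- exact: (g_smooth [:: i]).
Qed.

Lemma diff_gradient x u : 'd g x u = ((gradient g x)^T *m u) 0 0.
Proof.
rewrite [u in LHS]matrix_sum_delta linear_sum mxE; apply: eq_bigr => i _.
rewrite big_ord1 linearZ /= !mxE mulrC /partial deriveE //.
exact: smooth_differentiable.
Qed.

End Smooth.

Lemma is_derive_smooth (R : realType) d (g : 'cV[R]_d -> R) x u : smooth g ->
  is_derive x u g (((gradient g x)^T *m u) 0 0).
Proof.
by move=> sg; rewrite -diff_gradient //; apply/diff_is_derive/smooth_differentiable.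
Qed.

Lemma is_derive_gradient (R : realType) d (g : 'cV[R]_d -> R) x u : smooth g ->
  is_derive x u (gradient g) (hessian g x *m u).
Proof.
move=> sg; apply/is_derive_mxP => i j; under eq_fun do rewrite mxE.
have sp : smooth (partial i g).
  by move=> s y; have := sg (rcons s i) y; rewrite foldr_rcons.
rewrite ord1; apply: is_derive_eq (is_derive_smooth x u sp) _.
by rewrite !mxE; apply: eq_bigr => l _; rewrite !mxE.
Qed.

(** * Derivatives of the constraint data *)

Section StateCalculus.
Variables (R : realType) (d k : nat).
Local Notation state := 'M[R]_(d, 1 + (1 + k)).

Lemma differentiable_st_x (z : state) : differentiable (@st_x R d k) z.
Proof.
apply: mx_differentiable => i j; under eq_fun do rewrite mxE.
exact: differentiable_coord.
Qed.

Lemma differentiable_st_r (z : state) : differentiable (@st_r R d k) z.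
Proof.
apply: mx_differentiable => i j; under eq_fun do rewrite !mxE.
exact: differentiable_coord.
Qed.

Lemma differentiable_st_v (z : state) i : differentiable (fun z : state => st_v z i) z.
Proof.
apply: mx_differentiable => l j; under eq_fun do rewrite !mxE.
exact: differentiable_coord.
Qed.

Lemma differentiable_comp_st_x (W : normedModType R) (F : 'cV[R]_d -> W) (z : state) :
  differentiable F (st_x z) -> differentiable (fun z : state => F (st_x z)) z.
Proof.
by move=> dF; exact: (@differentiable_comp _ _ _ _ (@st_x R d k) F z
  (differentiable_st_x z) dF).
Qed.

Lemma mk_state_cases (P : 'I_(1 + (1 + k)) -> Prop) :
  P (lshift _ 0) -> P (rshift 1 (lshift _ 0)) ->
  (forall l, P (rshift 1 (rshift 1 l))) -> forall j, P j.
Proof.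
move=> Px Pr Pv j; case: (splitP j) => l jl.
  have -> : j = lshift _ l by apply/val_inj.
  by rewrite ord1.
have -> : j = rshift _ l by apply/val_inj.
case: (splitP l) => l' ll'.
  have -> : l = lshift _ l' by apply/val_inj.
  by rewrite ord1.
have -> : l = rshift _ l' by apply/val_inj.
exact: Pv.
Qed.

Section MkState.
Variables (V : normedModType R) (fx fr : V -> 'cV[R]_d) (fv : 'I_k -> V -> 'cV[R]_d).

Lemma differentiable_mk_state (y : V) :
  differentiable fx y -> differentiable fr y -> (forall i, differentiable (fv i) y) ->
  differentiable (fun y => mk_state (fx y) (fr y) (fun i => fv i y)) y.
Proof.
move=> dx dr dv; apply: mx_differentiable => i; apply: mk_state_cases => [||l].
- by under eq_fun do rewrite row_mxEl; exact: differentiable_entry.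
- by under eq_fun do rewrite row_mxEr row_mxEl; exact: differentiable_entry.
- by under eq_fun do rewrite !row_mxEr mxE; exact: differentiable_entry.
Qed.

Lemma is_derive_mk_state (y h : V) dx dr dv :
  is_derive y h fx dx -> is_derive y h fr dr -> (forall i, is_derive y h (fv i) (dv i)) ->
  is_derive y h (fun y => mk_state (fx y) (fr y) (fun i => fv i y)) (mk_state dx dr dv).
Proof.
move=> /is_derive_mxP Dx /is_derive_mxP Dr Dv; apply/is_derive_mxP => i.
apply: mk_state_cases => [||l].
- by rewrite row_mxEl; under eq_fun do rewrite row_mxEl.
- by rewrite row_mxEr row_mxEl; under eq_fun do rewrite row_mxEr row_mxEl.
- rewrite !row_mxEr mxE; under eq_fun do rewrite !row_mxEr mxE.
  by have /is_derive_mxP := Dv l; apply.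
Qed.

End MkState.

Lemma is_derive_comp_st_x (W : normedModType R) (F : 'cV[R]_d -> W) (z h : state) dF :
  is_derive (st_x z) (st_x h) F dF -> is_derive z h (fun z : state => F (st_x z)) dF.
Proof.
apply: is_derive_line => t; rewrite -[z in LHS]scale1r st_x_lin scale1r.
by [].
Qed.

Lemma is_derive_st_r (z h : state) : is_derive z h (@st_r R d k) (st_r h).
Proof.
apply: (is_derive_line (g := id) (x' := st_r z) (h' := st_r h)) => t.
by rewrite -[z in LHS]scale1r st_r_lin scale1r.
Qed.

Lemma is_derive_st_v (z h : state) i :
  is_derive z h (fun z : state => st_v z i) (st_v h i).
Proof.
apply: (is_derive_line (g := id) (x' := st_v z i) (h' := st_v h i)) => t.
by rewrite -[z in LHS]scale1r st_v_lin scale1r.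
Qed.

End StateCalculus.

Section Constraints.
Variables (R : realType) (d m : nat) (c : 'I_m -> 'cV[R]_d -> R) (f : 'cV[R]_d -> R).
Hypotheses (f_smooth : smooth f) (c_smooth : forall i, smooth (c i)).
Implicit Types (x u : 'cV[R]_d).

Lemma cgrad_differentiable x : differentiable (cgrad c) x.
Proof.
apply: mx_differentiable => i j; under eq_fun do rewrite mxE.
exact/differentiable_entry/gradient_differentiable.
Qed.

Lemma is_derive_cgrad x u : is_derive x u (cgrad c) (chess c x u).
Proof.
apply/is_derive_mxP => i j; under eq_fun do rewrite mxE.
rewrite mxE; have /is_derive_mxP := is_derive_gradient x u (c_smooth j); exact.
Qed.

Lemma gram_differentiable x :
  differentiable (fun y => (cgrad c y)^T *m cgrad c y) x.
Proof.
apply: differentiable_mulmx; last exact: cgrad_differentiable.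
exact/differentiable_trmx/cgrad_differentiable.
Qed.

Section Regular.
Variable x : 'cV[R]_d.
Hypothesis unit_x : (cgrad c x)^T *m cgrad c x \in unitmx.

Lemma gram_inv_differentiable : differentiable (gram_inv c) x.
Proof. by apply: differentiable_invmx => //; exact: gram_differentiable. Qed.

Lemma tproj_differentiable : differentiable (tproj c) x.
Proof.
apply: differentiableB; first exact: differentiable_cst.
apply: differentiable_mulmx; last exact/differentiable_trmx/cgrad_differentiable.
by apply: differentiable_mulmx; [exact: cgrad_differentiable|exact: gram_inv_differentiable].
Qed.

Lemma rgrad_differentiable : differentiable (rgrad c f) x.
Proof.
apply: differentiable_mulmx; first exact: tproj_differentiable.
exact: gradient_differentiable.
Qed.

(** Near x the projection kills the columns of A, so A y may be subtracted from
the gradient of f for the constant multipliers y of the point x. The difference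
vanishes at x, hence the derivative of the projection drops out. *)
Lemma is_derive_rgrad u : rgrad c f x = 0 ->
  is_derive x u (rgrad c f) (rhess c f x u).
Proof.
move=> crit; pose y := gram_inv c x *m (cgrad c x)^T *m gradient f x.
have resid : gradient f x - cgrad c x *m y = 0.
  by rewrite -crit /rgrad /tproj mulmxBl mul1mx /y !mulmxA.
apply: (@near_eq_is_derive _ _ _ (fun x' => tproj c x' *m (gradient f x' - cgrad c x' *m y))).
  near=> x'; rewrite mulmxBr mulmxA.
  have u' : (cgrad c x')^T *m cgrad c x' \in unitmx.
    by near: x'; apply: (near_unitmx (F := fun y => (cgrad c y)^T *m cgrad c y)) => //;
       exact: gram_differentiable.
  by rewrite [tproj c x' *m cgrad c x'](proj_kerA u') mul0mx subr0.
have D1 := diff_is_derive u tproj_differentiable.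
have D2 : is_derive x u (fun x' => gradient f x' - cgrad c x' *m y)
    (hessian f x *m u - chess c x u *m y).
  have Df := is_derive_gradient x u f_smooth.
  have Dc := is_derive_mulmx (is_derive_cgrad x u) (is_derive_cst y x u).
  by apply: is_derive_eq (is_deriveB Df Dc) _; rewrite mulmx0 addr0.
apply: is_derive_eq (is_derive_mulmx D1 D2) _.
by rewrite resid mulmx0 add0r /rhess /y !mulmxA.
Unshelve. all: by end_near. Qed.

End Regular.

Lemma chess0 x : chess c x 0 = 0.
Proof. by apply/matrixP => i j; rewrite !mxE big1 // => l _; rewrite !mxE mulr0. Qed.

Lemma normal_term0 x w : normal_term c x 0 w = 0.
Proof. by rewrite /normal_term chess0 trmx0 mulmx0 mul0mx. Qed.

End Constraints.

(** * Linearization of the system *)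

Section Curvature.
Variables (R : realType) (d m : nat) (c : 'I_m -> 'cV[R]_d -> R) (f : 'cV[R]_d -> R).
Hypotheses (f_smooth : smooth f) (c_smooth : forall i, smooth (c i)).
Implicit Types (x u : 'cV[R]_d).

(** The Hessian of the Lagrangian f - sum_i y_i c_i, the multipliers y being
constant. *)
Definition lagrangian_hessian x : 'M[R]_d :=
  let y := gram_inv c x *m (cgrad c x)^T *m gradient f x in
  hessian f x - \sum_i y i 0 *: hessian (c i) x.

Lemma lagrangian_hessian_sym x : (lagrangian_hessian x)^T = lagrangian_hessian x.
Proof.
rewrite /lagrangian_hessian linearB /= linear_sum hessian_sym //; congr (_ - _).
by apply: eq_bigr => i _; rewrite linearZ /= hessian_sym.
Qed.

Lemma rhessE x u : rhess c f x u = tproj c x *m lagrangian_hessian x *m u.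
Proof.
rewrite /rhess -[RHS]mulmxA; congr (_ *m _); rewrite mulmxBl; congr (_ - _).
rewrite mulmx_suml -!mulmxA [gram_inv c x *m _]mulmxA.
set y := _ *m gradient f x; apply/colP => j; rewrite mxE summxE.
by apply: eq_bigr => i _; rewrite -scalemxAl !mxE mulrC.
Qed.

Definition rhess_mx x : 'M[R]_d := tproj c x *m lagrangian_hessian x *m tproj c x.

Lemma rhess_mx_sym x : (rhess_mx x)^T = rhess_mx x.
Proof.
by rewrite /rhess_mx !trmx_mul lagrangian_hessian_sym [(tproj c x)^T]proj_ker_sym mulmxA.
Qed.

Lemma rhess_extE x u : rhess_ext c f x u = rhess_mx x *m u.
Proof. by rewrite /rhess_ext rhessE /rhess_mx !mulmxA. Qed.

End Curvature.

Section Linearization.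
Variables (R : realType) (d m k : nat) (c : 'I_m -> 'cV[R]_d -> R).
Variables (f : 'cV[R]_d -> R) (gamma1 gamma2 mu : R).
Hypotheses (f_smooth : smooth f) (c_smooth : forall i, smooth (c i)).
Local Notation state := 'M[R]_(d, 1 + (1 + k)).
Variable z : state.
Let x := st_x z.
Hypothesis unit_x : (cgrad c x)^T *m cgrad c x \in unitmx.

(** The penalty term as a matrix product, to which the product rule applies. *)
Lemma xdotE (z' : state) :
  xdot c mu z' = st_r z' - mu *: (cgrad c (st_x z') *m \col_i c i (st_x z')).
Proof.
congr (_ - _ *: _); apply/colP => j; rewrite summxE mxE.
by apply: eq_bigr => i _; rewrite !mxE mulrC.
Qed.

Lemma xdot_differentiable : differentiable (@xdot R d m k c mu) z.
Proof.
rewrite (funext xdotE); apply: differentiableB; first exact: differentiable_st_r.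
apply: differentiableZ; apply: differentiable_mulmx.
  exact/differentiable_comp_st_x/cgrad_differentiable.
apply: (differentiable_comp_st_x (F := fun x => \col_i c i x)).
apply: mx_differentiable => i j.
under eq_fun do rewrite mxE; exact: smooth_differentiable.
Qed.

Lemma normal_mx_differentiable : differentiable (fun z' : state =>
  cgrad c (st_x z') *m gram_inv c (st_x z') *m (chess c (st_x z') (xdot c mu z'))^T) z.
Proof.
apply: differentiable_mulmx.
  apply: differentiable_mulmx; first exact/differentiable_comp_st_x/cgrad_differentiable.
  exact/differentiable_comp_st_x/gram_inv_differentiable.
apply: differentiable_trmx; apply: mx_differentiable => i j.
under eq_fun do rewrite mxE; apply: differentiable_entry; apply: differentiable_mulmx.
  exact/differentiable_comp_st_x/hessian_differentiable.
exact: xdot_differentiable.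
Qed.

Lemma outer_differentiable (i j : 'I_k) :
  differentiable (fun z' : state => st_v z' i *m (st_v z' j)^T) z.
Proof.
apply: differentiable_mulmx; first exact: differentiable_st_v.
exact/differentiable_trmx/differentiable_st_v.
Qed.

Lemma rdot_differentiable : differentiable (@rdot R d m k c f gamma1 gamma2 mu) z.
Proof.
apply: differentiableB; last first.
  exact: differentiable_mulmx normal_mx_differentiable (differentiable_st_r z).
apply: differentiableB.
  by apply: differentiableN; apply: differentiableZ; exact: differentiable_st_r.
apply: differentiableZ; apply: differentiable_mulmx; last first.
  exact/differentiable_comp_st_x/rgrad_differentiable.
apply: differentiableB; first exact: differentiable_cst.
apply: differentiableZ; apply: differentiable_big => i _; exact: outer_differentiable.
Qed.

Lemma vdot_differentiable i : differentiable (fun z' : state => vdot c f mu z' i) z.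
Proof.
apply: differentiableB; last first.
  exact: differentiable_mulmx normal_mx_differentiable (differentiable_st_v z i).
apply: differentiableN; apply: differentiable_mulmx.
  apply: differentiableB.
    apply: differentiableB; first exact: differentiable_cst.
    exact: outer_differentiable.
  apply: differentiableZ; apply: differentiable_big => j _; exact: outer_differentiable.
have dP : differentiable (fun z' : state => tproj c (st_x z')) z.
  exact/differentiable_comp_st_x/tproj_differentiable.
under eq_fun do rewrite rhess_extE /rhess_mx.
apply: differentiable_mulmx; last exact: differentiable_st_v.
apply: differentiable_mulmx; last exact: dP.
apply: differentiable_mulmx; first exact: dP.
apply: (differentiable_comp_st_x (F := lagrangian_hessian c f)).
apply: differentiableB; first exact: hessian_differentiable.
apply: differentiable_big => i' _; apply: mx_differentiable => j1 j2.
under eq_fun do rewrite mxE.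
apply: differentiableM; last exact/differentiable_entry/hessian_differentiable.
apply: differentiable_entry; apply: differentiable_mulmx; last exact: gradient_differentiable.
apply: differentiable_mulmx; first exact: gram_inv_differentiable.
exact/differentiable_trmx/cgrad_differentiable.
Qed.

Lemma system_differentiable : differentiable (system_rhs c f gamma1 gamma2 mu) z.
Proof.
apply: differentiable_mk_state; [exact: xdot_differentiable|exact: rdot_differentiable|].
exact: vdot_differentiable.
Qed.

Hypotheses (x_constr : constraint_set c x) (r0 : st_r z = 0) (crit : rgrad c f x = 0).
Local Notation A := (cgrad c x).
Local Notation K := (rhess_mx c f x).

Lemma xdot_steady : xdot c mu z = 0.
Proof.
rewrite /xdot r0 big1 ?scaler0 ?subr0 // => i _.
by rewrite x_constr scale0r.
Qed.

(** The constraints vanish at x, so only their own derivative A^T u contributes. *)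
Lemma is_derive_xdot h :
  is_derive z h (@xdot R d m k c mu) (st_r h - mu *: (A *m (A^T *m st_x h))).
Proof.
rewrite (funext xdotE).
have c0 : \col_i c i x = 0 by apply/colP => i; rewrite !mxE x_constr.
have Dc : is_derive x (st_x h) (fun x' => \col_i c i x') (A^T *m st_x h).
  apply/is_derive_mxP => i j; under eq_fun do rewrite mxE.
  apply: is_derive_eq (is_derive_smooth x (st_x h) (c_smooth i)) _.
  by rewrite ord1 !mxE; apply: eq_bigr => l _; rewrite !mxE.
have D := is_derive_mulmx (is_derive_cgrad c_smooth x (st_x h)) Dc.
rewrite c0 mulmx0 add0r in D.
have D1 := is_derive_comp_st_x D; have D2 := is_derive_st_r z h.
exact: is_deriveB D2 (is_deriveZ mu D1).
Qed.

(** Each product has a factor that vanishes at z: the Riemannian gradient, or both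
r and the velocity of x. *)
Lemma is_derive_rdot h :
  is_derive z h (@rdot R d m k c f gamma1 gamma2 mu)
   (- (gamma1 *: st_r h) - gamma2 *:
      ((1%:M - 2 *: \sum_i st_v z i *m (st_v z i)^T)
        *m (tproj c x *m lagrangian_hessian c f x *m st_x h))).
Proof.
have D1 := is_derive_st_r z h.
have DS : differentiable (fun z' : state =>
    1%:M - 2 *: \sum_(i < k) st_v z' i *m (st_v z' i)^T) z.
  apply: differentiableB; first exact: differentiable_cst.
  apply: differentiableZ; apply: differentiable_big => i _; exact: outer_differentiable.
have D2 : is_derive z h (fun z' : state => rgrad c f (st_x z'))
    (tproj c x *m lagrangian_hessian c f x *m st_x h).
  by apply: is_derive_comp_st_x; rewrite -rhessE; exact: is_derive_rgrad.
have D3 := is_derive_mulmx (diff_is_derive h DS) D2.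
have D4 := is_derive_mulmx (diff_is_derive h normal_mx_differentiable) D1.
rewrite crit mulmx0 add0r in D3.
rewrite r0 xdot_steady chess0 trmx0 !mulmx0 mul0mx addr0 in D4.
have := is_deriveB (is_deriveB (is_deriveN (is_deriveZ gamma1 D1)) (is_deriveZ gamma2 D3)) D4.
by rewrite subr0.
Qed.

(** In a direction that fixes x and r the velocity of x stays zero and K stays
constant, so that only the frame varies. *)
Lemma is_derive_vdot h i : st_x h = 0 -> st_r h = 0 ->
  is_derive z h (fun z' : state => vdot c f mu z' i)
    (deflation_diff K (st_v z) (st_v h) i).
Proof.
move=> hx hr; pose v := st_v z; pose w := st_v h.
pose Dv j := is_derive_st_v z h j.
have Do j : is_derive z h (fun z' : state => st_v z' j *m (st_v z' j)^T)
    (w j *m (v j)^T + v j *m (w j)^T).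
  exact: is_derive_mulmx (Dv j) (is_derive_trmx (Dv j)).
have DK : is_derive z h (fun z' : state => K *m st_v z' i) (K *m w i).
  have := is_derive_mulmx (is_derive_cst K z h) (Dv i).
  by rewrite mul0mx add0r.
have Dsum : is_derive z h
    (fun z' : state => \sum_(j < k | (j < i)%N) st_v z' j *m (st_v z' j)^T)
    (\sum_(j < k | (j < i)%N) (w j *m (v j)^T + v j *m (w j)^T)).
  by apply: is_derive_big => j _; exact: Do.
have DW := is_deriveB (is_deriveB (is_derive_cst (1%:M : 'M[R]_d) z h) (Do i))
  (is_deriveZ 2 Dsum).
have D := is_deriveN (is_derive_mulmx DW DK).
apply: (is_derive_line (x' := z) (h' := h)) => [t|]; last first.
  apply: is_derive_eq D _.
  rewrite /deflation_diff -/v -/w sub0r -opprD mulNmx opprD opprK.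
  by [].
have lx : st_x (t *: h + z) = x by rewrite -[z]scale1r st_x_lin hx scaler0 add0r !scale1r.
have lr : st_r (t *: h + z) = 0 by rewrite -[z]scale1r st_r_lin hr r0 !scaler0 addr0.
rewrite /vdot; have -> : xdot c mu (t *: h + z) = 0.
  rewrite /xdot lx lr big1 ?scaler0 ?subr0 // => j _.
  by rewrite x_constr scale0r.
by rewrite lx normal_term0 subr0 rhess_extE.
Qed.

Lemma jacobian_x h : st_x ('d (system_rhs c f gamma1 gamma2 mu) z h) =
  st_r h - mu *: (A *m (A^T *m st_x h)).
Proof.
have D := is_derive_mk_state (is_derive_xdot h) (is_derive_rdot h)
  (fun i => diff_is_derive h (vdot_differentiable i)).
rewrite -deriveE; last exact: system_differentiable.
by rewrite (@derive_val _ _ _ _ _ _ _ D) st_x_mk.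
Qed.

Lemma jacobian_r h : st_r ('d (system_rhs c f gamma1 gamma2 mu) z h) =
  - (gamma1 *: st_r h) - gamma2 *:
      ((1%:M - 2 *: \sum_i st_v z i *m (st_v z i)^T)
        *m (tproj c x *m lagrangian_hessian c f x *m st_x h)).
Proof.
have D := is_derive_mk_state (is_derive_xdot h) (is_derive_rdot h)
  (fun i => diff_is_derive h (vdot_differentiable i)).
rewrite -deriveE; last exact: system_differentiable.
by rewrite (@derive_val _ _ _ _ _ _ _ D) st_r_mk.
Qed.

Lemma jacobian_v h i : st_x h = 0 -> st_r h = 0 ->
  st_v ('d (system_rhs c f gamma1 gamma2 mu) z h) i =
  deflation_diff K (st_v z) (st_v h) i.
Proof.
move=> hx hr.
have D := is_derive_mk_state (is_derive_xdot h) (is_derive_rdot h)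
  (fun i => is_derive_vdot i hx hr).
rewrite -deriveE; last exact: system_differentiable.
by rewrite (@derive_val _ _ _ _ _ _ _ D) st_v_mk.
Qed.

End Linearization.

(** * The spectrum of the Riemannian Hessian *)

Section Spectrum.
Import passmx.
Variables (R : realType) (d m : nat) (c : 'I_m -> 'cV[R]_d -> R) (f : 'cV[R]_d -> R).
Variable x : 'cV[R]_d.

Lemma tangentE (w : 'cV[R]_d) : (w \in tangent c x) = ((cgrad c x)^T *m w == 0).
Proof. by rewrite memv_ker lfunE. Qed.

Lemma tangent_proj (w : 'cV[R]_d) : w \in tangent c x -> tproj c x *m w = w.
Proof. by rewrite tangentE => /eqP; exact: proj_ker_id. Qed.

Lemma rhess_tangent (w : 'cV[R]_d) : w \in tangent c x ->
  rhess_mx c f x *m w = rhess c f x w.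
Proof. by move=> /tangent_proj Pw; rewrite rhessE -[in RHS]Pw !mulmxA. Qed.

Lemma rhess_opE (u : subvs_of (tangent c x)) :
  rhess_op c f x u = vsproj (tangent c x) (rhess c f x (vsval u)).
Proof.
pose g (u : subvs_of (tangent c x)) := vsproj (tangent c x) (rhess c f x (vsval u)).
have lin_g : linear g.
  by move=> t u1 u2; rewrite /g linearP !rhessE mulmxDr -scalemxAr linearP.
pose g' : {linear _ -> _} := HB.pack g (GRing.isLinear.Build _ _ _ _ g lin_g).
exact: (lfunE g' u).
Qed.

Variable s : seq R.
Hypothesis spec : eigenvalue_list (rhess_op c f x) s.

Lemma rhess_eigen_mem (w : 'cV[R]_d) b : w \in tangent c x -> w != 0 ->
  rhess c f x w = b *: w -> b \in s.
Proof.
move=> Tw nzw Hw; pose u := vsproj (tangent c x) w.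
have uw : vsval u = w by exact: vsprojK.
have Hu : rhess_op c f x u = b *: u by rewrite rhess_opE uw Hw linearZ.
have nzu : u != 0 by apply: contraNneq nzw => u0; rewrite -uw u0 linear0.
rewrite -root_prod_XsubC -spec -eigenvalue_root_char; apply/eigenvalueP.
exists (rVof (vbasis fullv) u); last by rewrite rVof_eq0 // vbasisP.
by rewrite -rVof_app ?vbasisP // Hu linearZ.
Qed.

Hypothesis unit_x : (cgrad c x)^T *m cgrad c x \in unitmx.
Hypotheses (f_smooth : smooth f) (c_smooth : forall i, smooth (c i)).

(** The matrix of the operator in a basis of the tangent space is U K V, where U
embeds coordinates into the ambient space and V takes the coordinates of the
projection; and K V U = K. So the two matrices are U (K V) and (K V) U. *)
Lemma char_poly_rhess :
  'X^(\dim {:subvs_of (tangent c x)}) * char_poly (rhess_mx c f x) =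
  'X^d * \prod_(a <- s) ('X - a%:P).
Proof.
rewrite -spec; set e := vbasis fullv; set T := tangent c x.
have eP : basis_of fullv e by exact: vbasisP.
set K := rhess_mx c f x; set P := tproj c x.
have PK : P *m K = K by rewrite /K /rhess_mx !mulmxA [P *m P]proj_ker_idem.
have KT : K^T = K by exact: rhess_mx_sym.
have TP (w : 'cV[R]_d) : P *m w \in T.
  by rewrite tangentE mulmxA [(cgrad c x)^T *m P]tr_proj_ker // mul0mx.
pose U := lin1_mx
  (trmx \o vsval \o vecof e : 'rV[R]_(\dim {:subvs_of T}) -> 'rV[R]_d).
pose V := lin1_mx (rVof e \o vsproj T \o mulmx P \o trmx : 'rV[R]_d -> 'rV[R]__).
have UE u : u *m U = (vsval (vecof e u))^T by rewrite mul_rV_lin1.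
have VE u : u *m V = rVof e (vsproj T (P *m u^T)) by rewrite mul_rV_lin1.
have UKV : U *m (K *m V) = mxof e e (rhess_op c f x).
  apply/row_matrixP => i; rewrite !rowE mulmxA mulmxA UE VE mul_mxof /=.
  set u := vecof e _; rewrite rhess_opE trmx_mul trmxK KT.
  by rewrite mulmxA PK rhess_tangent // subvsP.
have KVU : (K *m V) *m U = K.
  apply/row_matrixP => i; rewrite !rowE mulmxA (mulmxA _ K V) UE VE rVofK //.
  by rewrite vsprojK ?TP // [in P *m _]trmx_mul KT mulmxA PK trmx_mul trmxK KT.
by rewrite -UKV -[in LHS]KVU; exact: char_poly_mulmxC.
Qed.

End Spectrum.

(** Counting up from 0 gives i <= s i, counting down from k gives s i <= i. *)
Lemma increasing_ord_id k (s : 'I_k -> nat) :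
  (forall i j : 'I_k, (i < j)%N -> (s i < s j)%N) -> (forall i, (s i < k)%N) ->
  forall i, s i = i.
Proof.
move=> incr bnd i; apply/eqP; rewrite eqn_leq; apply/andP; split.
  have up n : forall j : 'I_k, (k - j <= n)%N -> (s j <= j)%N.
    elim: n => [|n IHn] j; first by have := ltn_ord j; lia.
    move=> jn; case: (ltnP j.+1 k) => [lt_jk|]; last by have := bnd j; lia.
    by have := IHn (Ordinal lt_jk); have := incr j (Ordinal lt_jk) => /=; lia.
  exact: up (leqnn _).
have lo n : forall j : 'I_k, (j <= n)%N -> (j <= s j)%N.
  elim: n => [|n IHn] j; first by lia.
  case: (posnP j) => [->//|j_gt0 jn].
  have lt_k : (j.-1 < k)%N by have := ltn_ord j; lia.
  by have := IHn (Ordinal lt_k); have := incr (Ordinal lt_k) j => /=; lia.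
exact: lo (leqnn _).
Qed.

(** * Stability of steady states *)

Section Equivalence.
Variables (R : realType) (d m k : nat) (c : 'I_m -> 'cV[R]_d -> R).
Variables (f : 'cV[R]_d -> R) (gamma1 gamma2 mu : R).
Hypotheses (f_smooth : smooth f) (c_smooth : forall i, smooth (c i)).
Variables (x : 'cV[R]_d) (v : 'I_k -> 'cV[R]_d).
Hypothesis unit_x : (cgrad c x)^T *m cgrad c x \in unitmx.
Hypothesis x_constr : constraint_set c x.
Hypothesis v_tangent : forall i, v i \in tangent c x.
Hypothesis v_unit : forall i, dot (v i) (v i) = 1.
Local Notation K := (rhess_mx c f x).
Local Notation F := (system_rhs c f gamma1 gamma2 mu).
Local Notation S := (1%:M - 2 *: \sum_i v i *m (v i)^T).

Lemma steady_stateP r : steady_state F (mk_state x r v) <->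
  [/\ r = 0, gamma2 *: (S *m rgrad c f x) = 0 &
   forall i : 'I_k, (1%:M - v i *m (v i)^T
      - 2 *: \sum_(j < k | (j < i)%N) v j *m (v j)^T) *m (K *m v i) = 0].
Proof.
set z := mk_state x r v.
have zx : st_x z = x by rewrite st_x_mk.
have zr : st_r z = r by rewrite st_r_mk.
have zv : st_v z = v by apply/funext => i; rewrite st_v_mk.
have xdotz : xdot c mu z = r.
  rewrite /xdot zr zx big1 ?scaler0 ?subr0 // => i _.
  by rewrite x_constr scale0r.
have rdotz : r = 0 -> rdot c f gamma1 gamma2 mu z = - (gamma2 *: (S *m rgrad c f x)).
  by move=> r0; rewrite /rdot xdotz zx zv zr r0 scaler0 normal_term0 oppr0 addr0 add0r.
have vdotz i : r = 0 -> vdot c f mu z i = - ((1%:M - v i *m (v i)^T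
      - 2 *: \sum_(j < k | (j < i)%N) v j *m (v j)^T) *m (K *m v i)).
  by move=> r0; rewrite /vdot xdotz zx zv r0 normal_term0 subr0 rhess_extE.
split=> [Fz|[r0 grad0 eig]].
  have := congr1 (@st_x R d k) Fz; rewrite /system_rhs st_x_mk st_x0 xdotz => r0.
  split=> // [|i]; apply: oppr_inj; rewrite oppr0.
    rewrite -rdotz //; have := congr1 (@st_r R d k) Fz.
    by rewrite /system_rhs st_r_mk st_r0.
  rewrite -vdotz //; have := congr1 (fun p => st_v p i) Fz.
  by rewrite /= /system_rhs st_v_mk st_v0.
apply: state_ext => [||i]; rewrite ?st_x_mk ?st_r_mk ?st_v_mk ?xdotz ?rdotz ?vdotz //.
- by rewrite r0 st_x0.
- by rewrite grad0 oppr0 st_r0.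
- by rewrite eig oppr0 st_v0.
Qed.

Hypothesis crit : rgrad c f x = 0.
Local Notation z := (mk_state x 0 v).
Hypothesis v_on : forall i j, dot (v i) (v j) = (i == j)%:R.

Lemma jacobian_at h :
  [/\ st_x ('d F z h) = st_r h - mu *: (cgrad c x *m ((cgrad c x)^T *m st_x h)),
   st_r ('d F z h) = - (gamma1 *: st_r h) - gamma2 *:
      (S *m (tproj c x *m lagrangian_hessian c f x *m st_x h)) &
   st_x h = 0 -> st_r h = 0 ->
     forall i, st_v ('d F z h) i = deflation_diff K v (st_v h) i].
Proof.
have zx : st_x z = x by rewrite st_x_mk.
have zr : st_r z = 0 by rewrite st_r_mk.
have zv : st_v z = v by apply/funext => i; rewrite st_v_mk.
have uz : (cgrad c (st_x z))^T *m cgrad c (st_x z) \in unitmx by rewrite zx.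
have cz : constraint_set c (st_x z) by rewrite zx.
have gz : rgrad c f (st_x z) = 0 by rewrite zx.
have Jx := jacobian_x gamma1 gamma2 mu f_smooth c_smooth uz cz zr gz h.
have Jr := jacobian_r gamma1 gamma2 mu f_smooth c_smooth uz cz zr gz h.
have Jv i := @jacobian_v _ _ _ _ _ _ gamma1 gamma2 mu f_smooth c_smooth _ uz cz zr gz h i.
rewrite zx in Jx; rewrite zx zv in Jr; split=> [||hx hr i]; [exact: Jx|exact: Jr|].
by have := Jv i hx hr; rewrite zx zv.
Qed.

(** The directions that fix x and r form an invariant subspace, so eigenvectors
of the linearized frame equations are eigenvectors of the Jacobian. *)
Lemma frame_eigenvalue (w : 'I_k -> 'cV[R]_d) i0 a : linearly_stable F z ->
  w i0 != 0 -> (forall i, deflation_diff K v w i = a *: w i) -> a < 0.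
Proof.
move=> [_ stab] nzw eig; pose h := mk_state 0 0 w.
have nzh : h != 0.
  by apply: contraNneq nzw => h0; rewrite -(st_v_mk 0 0 w) -/h h0 st_v0.
have hx : st_x h = 0 by rewrite st_x_mk.
have hr : st_r h = 0 by rewrite st_r_mk.
have hv : st_v h = w by apply/funext => i; rewrite st_v_mk.
have Dh : 'd F z h = a *: h.
  have [Jx Jr Jv] := jacobian_at h; apply: state_ext => [||i].
  - by rewrite Jx hx hr !mulmx0 scaler0 subr0 st_xZ hx scaler0.
  - by rewrite Jr hx hr !mulmx0 !scaler0 subr0 oppr0 st_rZ hr scaler0.
  - by rewrite Jv // hv eig st_vZ hv.
by have := stab _ (real_eigenvalue_lin_mx nzh Dh).
Qed.

Variable a : 'I_k -> R.
Hypothesis Kv : forall i, K *m v i = a i *: v i.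

Let v_neq0 i : v i != 0.
Proof. by rewrite -dot_eq0 v_on eqxx oner_eq0. Qed.

Lemma stable_neg : linearly_stable F z -> forall i, a i < 0.
Proof.
move=> stab i; suff: 2 * a i < 0 by lra.
apply: (frame_eigenvalue (w := fun j => if j == i then v i else 0) (i0 := i)) => //.
  by rewrite eqxx; exact: v_neq0.
move=> j; exact: (deflation_diff_self (rhess_mx_sym f_smooth c_smooth x) v_on Kv i j).
Qed.

Lemma stable_incr : linearly_stable F z ->
  forall i j : 'I_k, (i < j)%N -> a i < a j.
Proof.
move=> stab i j lt_ij; rewrite -subr_lt0.
apply: (frame_eigenvalue
  (w := fun l => if l == i then v j else if l == j then - v i else 0) (i0 := i)) => //.
  by rewrite eqxx; exact: v_neq0.
move=> l.
exact: (deflation_diff_swap (rhess_mx_sym f_smooth c_smooth x) v_on Kv l lt_ij).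
Qed.

Variables (n : nat) (lambda : 'I_n -> R).
Hypotheses (gamma1_gt0 : 0 < gamma1) (gamma2_gt0 : 0 < gamma2) (mu_gt0 : 0 < mu).
Hypothesis spec : eigenvalue_list (rhess_op c f x) [seq lambda i | i : 'I_n].
Hypothesis lambda_neq0 : forall i, lambda i != 0.
Hypothesis a_lt0 : forall i, a i < 0.
Hypothesis a_incr : forall i j : 'I_k, (i < j)%N -> a i < a j.
Hypothesis a_simple : forall i l1 l2, lambda l1 = a i -> lambda l2 = a i -> l1 = l2.
Hypothesis lambda_neg : forall l, lambda l < 0 -> exists i, lambda l = a i.

(** The spectrum of K in the ambient space is that of the Riemannian Hessian
padded with zeros, so the a_i remain simple and account for all its negative
elements. *)
Lemma frame_stable : linearly_stable F z.
Proof.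
have uz : (cgrad c (st_x z))^T *m cgrad c (st_x z) \in unitmx by rewrite st_x_mk.
split; first exact: (system_differentiable _ _ _ f_smooth c_smooth uz).
move=> al /eigenvalue_lin_mxP[p [q [nz Dp Dq]]].
rewrite ltNge; apply/negP => al_ge0.
have [E [b [EET EK]]] := symmetric_diagonalization (rhess_mx_sym f_smooth c_smooth x).
have perm := perm_spectrum EET EK (char_poly_rhess spec unit_x f_smooth c_smooth).
have PP := proj_ker_idem unit_x.
case: (@no_unstable_pair R d m k (cgrad c x) (tproj c x *m lagrangian_hessian c f x)
  K E b v a gamma1 gamma2 mu ('d F z) gamma1_gt0 gamma2_gt0 mu_gt0 unit_x _ _ _ _
  EET EK v_on Kv a_lt0 a_incr _ _ _ _ _ p q _ _ al_ge0 Dp Dq).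
- exact: rhess_mx_sym.
- by rewrite mulmxA PP.
- by [].
- move=> w Pw Kw; apply/eqP/negPn/negP => nzw.
  have Tw : w \in tangent c x.
    by rewrite tangentE -Pw mulmxA tr_proj_ker // mul0mx.
  have /mapP[i _ li] : 0 \in [seq lambda i | i : 'I_n].
    by apply: (rhess_eigen_mem spec Tw nzw); rewrite -rhess_tangent // Kw scale0r.
  by have := lambda_neq0 i; rewrite -li eqxx.
- move=> i; apply: (perm_simple perm); first by rewrite lt_eqF.
  exact: a_simple.
- move=> l bl; have /mapP[i _ bi] : b 0 l \in [seq lambda i | i : 'I_n].
    by apply: perm_mem_nz perm _ _; [apply: map_f; rewrite mem_enum|rewrite lt_eqF].
  by rewrite bi; apply: lambda_neg; rewrite -bi.
- by move=> h; have [] := jacobian_at h.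
- by move=> h; have [] := jacobian_at h.
- by move=> h hx hr; have [_ _] := jacobian_at h; apply.
by move=> p0 q0; move: nz; rewrite p0 q0 eqxx.
Qed.

End Equivalence.

Theorem proposition3p3 (R : realType) (d m k : nat)
  (k_gt0 : (0 < k)%N) (k_lt : (k < d - m)%N)
  (f : 'cV[R]_d -> R) (c : 'I_m -> 'cV[R]_d -> R)
  (f_smooth : smooth f) (c_smooth : forall i, smooth (c i))
  (full_rank : forall x, constraint_set c x -> \rank (cgrad c x) = m)
  (gamma1 gamma2 mu : R)
  (gamma1_gt0 : 0 < gamma1) (gamma2_gt0 : 0 < gamma2) (mu_gt0 : 0 < mu)
  (x r : 'cV[R]_d) (v : 'I_(d - m) -> 'cV[R]_d) (lambda : 'I_(d - m) -> R)
  (x_constr : constraint_set c x)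
  (v_tangent : forall i, v i \in tangent c x)
  (v_unit : forall i, enorm (v i) = 1)
  (lambda_eig : eigenvalue_list (rhess_op c f x) [seq lambda i | i : 'I_(d - m)])
  (lambda_neg : forall i : 'I_(d - m), (i < k)%N -> lambda i < 0)
  (lambda_pos : forall i : 'I_(d - m), (k <= i)%N -> 0 < lambda i)
  (lambda_incr : forall i j : 'I_(d - m),
    (i < j)%N -> (j < k)%N -> lambda i < lambda j)
  (lambda_nondecr : forall i j : 'I_(d - m),
    (k <= i)%N -> (i <= j)%N -> lambda i <= lambda j) :
  let z := mk_state x r (fun i : 'I_k => v (widen_ord (ltnW k_lt) i)) in
  let F := system_rhs c f gamma1 gamma2 mu in
  (steady_state F z /\ linearly_stable F z) <->
  [/\ index_saddle c f k x,
      r = 0 &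
      forall i : 'I_(d - m), (i < k)%N -> rhess c f x (v i) = lambda i *: v i].
Proof.
move=> z F; pose n := (d - m)%N; pose wi (i : 'I_k) : 'I_n := widen_ord (ltnW k_lt) i.
pose vk i := v (wi i).
have unit_x : (cgrad c x)^T *m cgrad c x \in unitmx.
  exact/full_rank_gram/full_rank.
have vk_tangent i : vk i \in tangent c x by exact: v_tangent.
have vk1 i : dot (vk i) (vk i) = 1 by exact/enorm1_dot/v_unit.
have symK := rhess_mx_sym f_smooth c_smooth x.
have lam_neq0 i : lambda i != 0.
  by case: (ltnP i k) => [/lambda_neg/lt_eqF|/lambda_pos/gt_eqF] ->.
have lam_ltk i : lambda i < 0 -> (i < k)%N.
  by move=> li; rewrite ltnNge; apply/negP => /lambda_pos; rewrite ltNge (ltW li).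
have lam_inj (i j : 'I_n) : (j < k)%N -> lambda i = lambda j -> i = j.
  move=> jk Eij; have ik : (i < k)%N by apply: lam_ltk; rewrite Eij lambda_neg.
  case: (ltngtP i j) => [lt|lt|/val_inj //].
    by have := lambda_incr _ _ lt jk; rewrite Eij ltxx.
  by have := lambda_incr _ _ lt ik; rewrite Eij ltxx.
have eig_lambda w b : w \in tangent c x -> w != 0 ->
    rhess_mx c f x *m w = b *: w -> exists i, b = lambda i.
  move=> Tw nzw Kw; have /mapP[i _ ->] : b \in [seq lambda i | i : 'I_n].
    by apply: (rhess_eigen_mem lambda_eig Tw nzw); rewrite -rhess_tangent.
  by exists i.
have vk_neq0 i : vk i != 0 by rewrite -dot_eq0 vk1 oner_eq0.
have saddle : rgrad c f x = 0 -> index_saddle c f k x.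
  move=> crit; split=> //; exists [seq lambda i | i : 'I_n] => //.
  rewrite count_map -sum1_count big_enum_cond /=.
  rewrite (eq_bigl (fun i : 'I_n => (i < k)%N)) => [|i].
    by rewrite (big_ord_narrow (ltnW k_lt)) sum1_card card_ord.
  by apply/idP/idP => [/lam_ltk|/lambda_neg].
split=> [[/(steady_stateP f gamma1 gamma2 mu vk x_constr)[r0 Sgrad steady] stab]|].
  have nz_eig i a : rhess_mx c f x *m vk i = a *: vk i -> a != 0.
    by move=> /(eig_lambda _ _ (vk_tangent i) (vk_neq0 i))[j ->].
  have [v_on Kv] := deflated_eigenvectors symK vk1 nz_eig steady.
  have crit : rgrad c f x = 0.
    move: Sgrad => /eqP; rewrite scaler_eq0 gt_eqF //= => /eqP Sgrad.
    by rewrite -[LHS]mul1mx -(householder_invol v_on) -mulmxA Sgrad mulmx0.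
  split=> //; first exact: saddle.
  rewrite /z r0 in stab.
  have a_lt0 := stable_neg f_smooth c_smooth unit_x x_constr crit v_on Kv stab.
  have a_incr := stable_incr f_smooth c_smooth unit_x x_constr crit v_on Kv stab.
  (* a_i = lambda_(s i) with s increasing and below k, hence s is the inclusion *)
  have /choice[s sP] : forall i, exists j, dot (vk i) (rhess_mx c f x *m vk i) = lambda j.
    by move=> i; apply: eig_lambda (vk_tangent i) (vk_neq0 i) (Kv i).
  have s_ltk i : (s i < k)%N by apply: lam_ltk; rewrite -sP.
  have s_incr (i j : 'I_k) : (i < j)%N -> (s i < s j)%N.
    move=> /a_incr; rewrite !sP; case: (ltngtP (s i) (s j)) => // [lt|/val_inj ->].
      by rewrite ltNge (ltW (lambda_incr _ _ lt (s_ltk i))).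
    by rewrite ltxx.
  move=> i ik; have := Kv (Ordinal ik).
  have wiE : wi (Ordinal ik) = i by apply/val_inj.
  rewrite sP rhess_tangent // /vk wiE => ->; congr (lambda _ *: _).
  exact/val_inj/(increasing_ord_id (s := s) s_incr s_ltk).
move=> [[[_ crit] _] r0 eig].
have Kv i : rhess_mx c f x *m vk i = lambda (wi i) *: vk i.
  by rewrite rhess_tangent // eig //= ltn_ord.
have v_on i j : dot (vk i) (vk j) = (i == j)%:R.
  case: eqVneq => [->|neq]; first exact: vk1.
  apply: (eigen_ortho symK (Kv i) (Kv j)); apply: contraNneq neq => /lam_inj.
  by move=> /(_ (ltn_ord j)) /(congr1 val) /= /val_inj ->.
split.
  apply/(steady_stateP f gamma1 gamma2 mu vk x_constr); split=> // [|i].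
    by rewrite crit mulmx0 scaler0.
  rewrite Kv -scalemxAr !mulmxBl mul1mx mul_outer vk1 scale1r subrr sub0r.
  rewrite -scalemxAl mul_outer_sum big1 ?scaler0 ?oppr0 ?scaler0 // => j lt_ji.
  by rewrite v_on -(inj_eq val_inj) ltn_eqF // scale0r.
rewrite /z r0; apply: (frame_stable f_smooth c_smooth unit_x x_constr crit v_on Kv
  gamma1_gt0 gamma2_gt0 mu_gt0 lambda_eig lam_neq0) => [i|i j lt|i l1 l2 E1 E2|l ll].
- by apply: lambda_neg; rewrite /= ltn_ord.
- by apply: lambda_incr; rewrite //= ltn_ord.
- by rewrite (lam_inj _ _ _ E1) ?(lam_inj _ _ _ E2) //= ltn_ord.
- by exists (Ordinal (lam_ltk l ll)); congr lambda; apply/val_inj.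
Qed.
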